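(* Let $(M,g)$ be a complete Riemannian manifold of dimension $n\ge 2$ that is a gradient Ricci soliton, i.e. there are $u\in C^\infty(M)$ and a constant $\lambda\in\mathbb{R}$ with $$\nabla^2u+Ric=\lambda g .$$ If $u$ is a non-constant concave function and $(M,g)$ has bounded Ricci curvature, i.e. $|Ric|\le K$ on $M$ for some constant $K>0$, then the Ricci soliton is non-shrinking, i.e. $\lambda\le 0$.
   Context: Manifolds are smooth and connected. $\nabla^2u$ denotes the Hessian of $u$ and $Ric$ the Ricci tensor. The soliton is called shrinking if $\lambda>0$, steady if $\lambda=0$, and expanding if $\lambda<0$. A smooth function $\varphi:M\to\mathbb{R}$ is convex if for every $q\in M$ and every $v\in T_qM$ one has $\langle \nabla\varphi,v\rangle_q\le \varphi(\exp_q v)-\varphi(q)$, where $\nabla\varphi$ is the gradient; $u$ is concave if $-u$ is convex. *)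

(* Defs.v *)
From HB Require Import structures.
From mathcomp Require Import all_boot all_order all_algebra.
From mathcomp Require Import all_classical all_reals all_analysis.
Set Implicit Arguments.
Unset Strict Implicit.
Unset Printing Implicit Defensive.
Import Order.TTheory GRing.Theory Num.Theory numFieldNormedType.Exports.
Local Open Scope classical_set_scope.
Local Open Scope ring_scope.

Definition pder (R : realType) (n : nat) (a : 'I_n) (f : 'rV[R]_n -> R)
  : 'rV[R]_n -> R := fun x => 'D_(delta_mx 0 a) f x.

(* C^k on an open set U: all iterated partial derivatives of order at most k
   exist and are continuous at every point of U. *)
Fixpoint Ck_on (R : realType) (n k : nat) (U : set 'rV[R]_n)
    (f : 'rV[R]_n -> R) : Prop :=
  (forall x, U x -> {for x, continuous f}) /\
  match k with
  | 0%N => True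
  | k'.+1 => forall a : 'I_n,
      (forall x, U x -> derivable f x (delta_mx 0 a)) /\ Ck_on k' U (pder a f)
  end.

Definition smooth_on (R : realType) (n : nat) (U : set 'rV[R]_n)
    (f : 'rV[R]_n -> R) : Prop := forall k, Ck_on k U f.

(* A connected smooth manifold, given by a (not necessarily maximal) atlas.
   [phi i] is a homeomorphism from the open set [dom i] onto the open set
   [cod i], with inverse [psi i]; both are total functions whose values
   elsewhere are irrelevant. *)
Record manifold (R : realType) (n : nat) (M : topologicalType) := Manifold {
  chart : Type;
  dom : chart -> set M;
  cod : chart -> set 'rV[R]_n;
  phi : chart -> M -> 'rV[R]_n;
  psi : chart -> 'rV[R]_n -> M;
  mfd_hausdorff : hausdorff_space M;
  mfd_second_countable : @second_countable M;
  mfd_connected : connected [set: M];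
  dom_cover : forall p, exists i, dom i p;
  dom_open : forall i, open (dom i);
  cod_open : forall i, open (cod i);
  phi_cod : forall i p, dom i p -> cod i (phi i p);
  psi_dom : forall i x, cod i x -> dom i (psi i x);
  phiK : forall i p, dom i p -> psi i (phi i p) = p;
  psiK : forall i x, cod i x -> phi i (psi i x) = x;
  phi_continuous : forall i p, dom i p -> {for p, continuous (phi i)};
  psi_continuous : forall i x, cod i x -> {for x, continuous (psi i)};
  transition_smooth : forall i j (k : 'I_n),
    smooth_on (cod i `&` psi i @^-1` dom j)
              (fun x => phi j (psi i x) 0 k)
}.

Section Manifold.
Context {R : realType} {n : nat} {M : topologicalType}.
Variable A : manifold R n M.

Definition loc (u : M -> R) (i : chart A) : 'rV[R]_n -> R :=
  fun x => u (psi i x).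

Definition smooth_fun (u : M -> R) : Prop :=
  forall i : chart A, smooth_on (cod i) (loc u i).

(* [metric i x] is the matrix (g_ab) in the chart i, at coordinates x; the last
   field says that these matrices represent one covariant 2-tensor. *)
Record riemannian_metric := RiemannianMetric {
  metric : chart A -> 'rV[R]_n -> 'M[R]_n;
  metric_sym : forall i x, cod i x -> (metric i x)^T = metric i x;
  metric_posdef : forall i x, cod i x ->
    forall v : 'rV[R]_n, v != 0 -> 0 < (v *m metric i x *m v^T) 0 0;
  metric_smooth : forall i (a b : 'I_n),
    smooth_on (cod i) (fun x => metric i x a b);
  metric_transition : forall i j x, cod i x -> dom j (psi i x) ->
    forall a b : 'I_n,
    metric i x a b =
    \sum_(k < n) \sum_(l < n)
      pder a (fun y => phi j (psi i y) 0 k) x *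
      pder b (fun y => phi j (psi i y) 0 l) x *
      metric j (phi j (psi i x)) k l
}.

Section Geometry.
Variable g : riemannian_metric.

(* Below, x denotes coordinates in [cod i]; tangent vectors at [psi i x] are
   given by the row of their components in the coordinate frame of i. *)

Definition inner (i : chart A) (x v w : 'rV[R]_n) : R :=
  (v *m metric g i x *m w^T) 0 0.

Definition ginv (i : chart A) (x : 'rV[R]_n) : 'M[R]_n := invmx (metric g i x).

(* Gamma^k_ab *)
Definition christoffel (i : chart A) (k a b : 'I_n) (x : 'rV[R]_n) : R :=
  2^-1 * \sum_(l < n) ginv i x k l *
    (pder a (fun y => metric g i y b l) x
     + pder b (fun y => metric g i y a l) x
     - pder l (fun y => metric g i y a b) x).

(* The component along d_d of R(d_a, d_b) d_c, where
   R(X, Y) Z = nabla_X nabla_Y Z - nabla_Y nabla_X Z - nabla_[X,Y] Z. *)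
Definition riemann (i : chart A) (d c a b : 'I_n) (x : 'rV[R]_n) : R :=
  pder a (christoffel i d b c) x - pder b (christoffel i d a c) x
  + \sum_(e < n) (christoffel i d a e x * christoffel i e b c x
                  - christoffel i d b e x * christoffel i e a c x).

(* Ric(Y, Z) = trace (X |-> R(X, Y) Z), which is positive on round spheres. *)
Definition ricci (i : chart A) (x : 'rV[R]_n) : 'M[R]_n :=
  \matrix_(b, c) \sum_(a < n) riemann i a c a b x.

Definition hessian (u : M -> R) (i : chart A) (x : 'rV[R]_n) : 'M[R]_n :=
  \matrix_(a, b) (pder a (pder b (loc u i)) x
    - \sum_(k < n) christoffel i k a b x * pder k (loc u i) x).

Definition gradient (u : M -> R) (i : chart A) (x : 'rV[R]_n) : 'rV[R]_n :=
  \row_k \sum_(l < n) ginv i x k l * pder l (loc u i) x.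

(* |T|^2 = g^ac g^bd T_ab T_cd *)
Definition tensor_norm (i : chart A) (x : 'rV[R]_n) (T : 'M[R]_n) : R :=
  Num.sqrt (\sum_(a < n) \sum_(b < n) \sum_(c < n) \sum_(d < n)
    ginv i x a c * ginv i x b d * T a b * T c d).

Definition curve_coord (gamma : R -> M) (i : chart A) (k : 'I_n) : R -> R :=
  fun t => phi i (gamma t) 0 k.

Definition velocity (gamma : R -> M) (i : chart A) (t : R) : 'rV[R]_n :=
  \row_k derive1 (curve_coord gamma i k) t.

Definition smooth_curve (gamma : R -> M) : Prop :=
  continuous gamma /\
  forall (i : chart A) (k : 'I_n) (m : nat) (t : R), dom i (gamma t) ->
    derivable (derive1n m (curve_coord gamma i k)) t 1.

Definition geodesic (gamma : R -> M) : Prop :=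
  smooth_curve gamma /\
  forall (i : chart A) (t : R), dom i (gamma t) -> forall k : 'I_n,
    derive1n 2 (curve_coord gamma i k) t
    + \sum_(a < n) \sum_(b < n) christoffel i k a b (phi i (gamma t)) *
        velocity gamma i t 0 a * velocity gamma i t 0 b = 0.

(* gamma is the geodesic defined on all of R that starts at q with the velocity
   whose components in the chart i around q are v. *)
Definition geodesic_from (q : M) (i : chart A) (v : 'rV[R]_n)
    (gamma : R -> M) : Prop :=
  [/\ geodesic gamma, gamma 0 = q & velocity gamma i 0 = v].

(* p = exp_q v *)
Definition is_exp (q : M) (i : chart A) (v : 'rV[R]_n) (p : M) : Prop :=
  exists2 gamma, geodesic_from q i v gamma & p = gamma 1.

(* Geodesic completeness: exp_q is defined on all of T_q M, for every q. *)
Definition complete_metric : Prop :=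
  forall (q : M) (i : chart A), dom i q ->
  forall v : 'rV[R]_n, exists gamma, geodesic_from q i v gamma.

(* <grad f, v>_q <= f (exp_q v) - f q. On a complete manifold exp_q v exists
   (and is unique), so the quantification over p is never vacuous. *)
Definition convex_fun (f : M -> R) : Prop :=
  smooth_fun f /\
  forall (q : M) (i : chart A), dom i q -> forall (v : 'rV[R]_n) (p : M),
    is_exp q i v p ->
    inner i (phi i q) (gradient f i (phi i q)) v <= f p - f q.

Definition concave_fun (f : M -> R) : Prop := convex_fun (fun p => - f p).

Definition gradient_ricci_soliton (u : M -> R) (lambda : R) : Prop :=
  smooth_fun u /\
  forall (i : chart A) (x : 'rV[R]_n), cod i x ->
    hessian u i x + ricci i x = lambda *: metric g i x.

Definition bounded_ricci (K : R) : Prop :=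
  forall (i : chart A) (x : 'rV[R]_n), cod i x ->
    tensor_norm i x (ricci i x) <= K.

End Geometry.
End Manifold.

(* Main.v *)
Require Import Defs.
From HB Require Import structures.
From mathcomp Require Import all_boot all_order all_algebra.
From mathcomp Require Import all_classical all_reals all_analysis.
From mathcomp Require Import ring lra.
Set Implicit Arguments.
Unset Strict Implicit.
Unset Printing Implicit Defensive.
Import Order.TTheory GRing.Theory Num.Theory numFieldNormedType.Exports.
Local Open Scope ring_scope.

(** Hamilton's identity: on a gradient Ricci soliton the function
    [scal + |grad u|^2 - 2 lambda u] is constant.  If [lambda > 0], a lower bound
    on [scal] therefore bounds [u] from below.  But [f = - u] is convex, so at a
    point [q] where [v = grad f] does not vanish
    [s |v|^2 <= f (exp_q (s v)) - f q] for every [s], and [f] is unbounded above.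

    Hamilton's identity follows from the contracted second Bianchi identity and
    the commutation of covariant derivatives.  These are computed in the
    commutative ring of smooth functions on a chart domain, whose partial
    derivatives are commuting derivations.  To compare charts, [scal] is replaced
    by [n lambda - div (grad u)], whose invariance involves first derivatives of
    the metric only. *)

(** * Curvature over a ring with commuting derivations *)

(** The bound on [Ric] enters through its trace: in an orthonormal frame [|Ric| <= K] bounds every
    diagonal entry, so [scal >= - n K], that is, [div (grad u) <= n lambda + n K]. Since
    [|grad u|^2 >= 0], constancy of Hamilton's function then bounds [2 lambda u] from below. The
    constancy rests on [d scal = 2 Ric(grad u)]. It comes from taking the divergence of the soliton
    equation: commuting derivatives rewrites the divergence of the Hessian, and Bianchi rewrites
    that of [Ric]. The equation also gives [d |grad u|^2 = 2 lambda du - 2 Ric(grad u)], and the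
    Ricci terms cancel. Storing the connection as one matrix [Gam a] per direction turns tensor
    identities into noncommutative matrix identities. The price is that functions are total while
    their calculus is valid only on the chart domain, so all data must be normalised outside it.
    Vanishing of the differential is moreover a statement inside one chart; a global constant
    requires chart invariance together with connectedness. *)

Lemma addmxE (S : pzRingType) m p (A B : 'M[S]_(m, p)) i j :
  (A + B) i j = A i j + B i j.
Proof. by rewrite mxE. Qed.

Lemma oppmxE (S : pzRingType) m p (A : 'M[S]_(m, p)) i j : (- A) i j = - A i j.
Proof. by rewrite mxE. Qed.

Lemma zeromxE (S : pzRingType) m p (i : 'I_m) (j : 'I_p) :
  (0 : 'M[S]_(m, p)) i j = 0.
Proof. by rewrite mxE. Qed.

Lemma trmxD (S : pzRingType) m p (A B : 'M[S]_(m, p)) : (A + B)^T = A^T + B^T.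
Proof. by apply/matrixP => i j; rewrite !mxE. Qed.

Lemma trmxN (S : pzRingType) m p (A : 'M[S]_(m, p)) : (- A)^T = - A^T.
Proof. by apply/matrixP => i j; rewrite !mxE. Qed.

(** Once products have been distributed, the matrix identities below are additive, with every
    product an opaque atom; entrywise [ring] settles them. *)
Ltac mx_abel := apply/matrixP => ? ?; rewrite ?(addmxE, oppmxE, zeromxE); ring.

Section DifferentialRing.
Variables (S : comPzRingType) (n : nat) (d : 'I_n -> S -> S).
Hypothesis dD : forall a x y, d a (x + y) = d a x + d a y.
Hypothesis dM : forall a x y, d a (x * y) = d a x * y + x * d a y.
Hypothesis dC : forall a b x, d a (d b x) = d b (d a x).

Lemma d_0 a : d a 0 = 0.
Proof. by apply: (addrI (d a 0)); rewrite -dD !addr0. Qed.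

Lemma d_1 a : d a 1 = 0.
Proof. by apply: (addrI (d a 1)); rewrite addr0 -{3}[1]mulr1 dM mulr1 mul1r. Qed.

Lemma d_opp a x : d a (- x) = - d a x.
Proof. by apply: (addrI (d a x)); rewrite -dD !subrr d_0. Qed.

Lemma d_sum a I (r : seq I) (P : pred I) (F : I -> S) :
  d a (\sum_(i <- r | P i) F i) = \sum_(i <- r | P i) d a (F i).
Proof. exact: (big_morph (d a) (dD a) (d_0 a)). Qed.

Definition dmx a p q (A : 'M[S]_(p, q)) := map_mx (d a) A.

Lemma dmxE a p q (A : 'M[S]_(p, q)) i j : dmx a A i j = d a (A i j).
Proof. by rewrite mxE. Qed.

Lemma dmxD a p q (A B : 'M[S]_(p, q)) : dmx a (A + B) = dmx a A + dmx a B.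
Proof. by apply/matrixP => i j; rewrite !mxE dD. Qed.

Lemma dmxN a p q (A : 'M[S]_(p, q)) : dmx a (- A) = - dmx a A.
Proof. by apply/matrixP => i j; rewrite !mxE d_opp. Qed.

Lemma dmxM a p q r (A : 'M[S]_(p, q)) (B : 'M[S]_(q, r)) :
  dmx a (A *m B) = dmx a A *m B + A *m dmx a B.
Proof.
apply/matrixP => i j; rewrite !mxE d_sum -big_split /=.
by apply: eq_bigr => k _; rewrite !mxE dM.
Qed.

Lemma dmxT a p q (A : 'M[S]_(p, q)) : dmx a A^T = (dmx a A)^T.
Proof. by apply/matrixP => i j; rewrite !mxE. Qed.

Lemma dmxC a b p q (A : 'M[S]_(p, q)) : dmx a (dmx b A) = dmx b (dmx a A).
Proof. by apply/matrixP => i j; rewrite !mxE dC. Qed.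

Lemma dmx1 a p : dmx a (1%:M : 'M[S]_p) = 0.
Proof. by apply/matrixP => i j; rewrite !mxE; case: (i == j); rewrite ?d_0 ?d_1. Qed.

(* [Gam a] is the matrix whose row [k], column [c] entry is [Gamma^k_ac]. *)
Variables (G G' : 'M[S]_n) (Gam : 'I_n -> 'M[S]_n).
Hypothesis GG' : G *m G' = 1%:M.
Hypothesis G'G : G' *m G = 1%:M.
Hypothesis Gsym : G^T = G.
Hypothesis compat : forall a, dmx a G = (Gam a)^T *m G + G *m Gam a.
Hypothesis torsion_free : forall a k c, Gam a k c = Gam c k a.

Lemma G'sym : G'^T = G'.
Proof.
have : G'^T *m G *m G' = G' by rewrite -{1}Gsym -trmx_mul GG' trmx1 mul1mx.
by rewrite -mulmxA GG' mulmx1.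
Qed.

(** Differentiate [G' *m G = 1] and cancel [G] on the right: the inverse metric is parallel as
    well. *)
Lemma compat_inv a : dmx a G' = - (Gam a *m G' + G' *m (Gam a)^T).
Proof.
have : dmx a (G' *m G) *m G' = 0 by rewrite G'G dmx1 mul0mx.
rewrite dmxM compat mulmxDl -mulmxA GG' mulmx1 mulmxDr mulmxDl.
rewrite mulmxA -(mulmxA _ G) GG' mulmx1 (mulmxA G' G) G'G mul1mx => /eqP.
by rewrite addr_eq0 addrC => /eqP.
Qed.

(** The curvature form of the connection [d + Gam]: entry [(k, c)] is the component along [d_k] of
    [R(d_a, d_b) d_c]. *)
Definition curv a b : 'M[S]_n :=
  dmx a (Gam b) - dmx b (Gam a) + Gam a *m Gam b - Gam b *m Gam a.

Lemma curvE a b k c : curv a b k c =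
  d a (Gam b k c) - d b (Gam a k c) +
  \sum_e (Gam a k e * Gam b e c - Gam b k e * Gam a e c).
Proof. by rewrite /curv !(addmxE, oppmxE) !dmxE !mxE sumrB addrA. Qed.

Lemma curvN a b : curv a b = - curv b a.
Proof. rewrite /curv; mx_abel. Qed.

(** The second Bianchi identity is the Jacobi identity for the operators [d_a + Gam a], whose
    commutators are the curvatures. The Christoffel terms that a full covariant derivative attaches
    to the two form indices cancel in the cyclic sum of a torsion-free connection, so they are left
    out from the start. *)
Lemma curv_bianchi a b c :
  (dmx c (curv a b) + Gam c *m curv a b - curv a b *m Gam c) +
  (dmx a (curv b c) + Gam a *m curv b c - curv b c *m Gam a) +
  (dmx b (curv c a) + Gam b *m curv c a - curv c a *m Gam b) = 0.
Proof.
rewrite /curv !(dmxD, dmxN, dmxM) !(mulmxDl, mulmxDr, mulmxN, mulNmx) !mulmxA.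
rewrite (dmxC c a) (dmxC c b) (dmxC b a); mx_abel.
Qed.

(** With one index raised, the metric antisymmetry of the curvature becomes antisymmetry of a
    matrix. *)
Definition rcurv a b : 'M[S]_n := curv a b *m G'.

Lemma rcurvN a b : rcurv a b = - rcurv b a.
Proof. by rewrite /rcurv curvN mulNmx. Qed.

(** [G'] is parallel, so the curvature annihilates it: expanding the commuting second derivatives of
    [G'] by [compat_inv] leaves [curv a b *m G' + G' *m (curv a b)^T = 0]. *)
Lemma rcurvT a b : (rcurv a b)^T = - rcurv a b.
Proof.
rewrite /rcurv trmx_mul G'sym.
have := dmxC a b G'; rewrite !(compat_inv, dmxN, dmxD, dmxM, dmxT).
move=> /eqP; rewrite -subr_eq0 => /eqP E; rewrite -[RHS]subr0 -E /curv.
rewrite !(compat_inv, trmxD, trmxN) !trmx_mul.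
rewrite !(mulmxDl, mulmxDr, mulmxN, mulNmx) !mulmxA; mx_abel.
Qed.

(** Covariant derivative in the two upper indices; the form indices of [rcurv] are again left
    uncorrected. *)
Definition cov c (E : 'M[S]_n) := dmx c E + Gam c *m E + E *m (Gam c)^T.

(** Since [G'] is parallel, raising an index commutes with covariant differentiation. *)
Lemma rcurv_bianchi a b c :
  cov c (rcurv a b) + cov a (rcurv b c) + cov b (rcurv c a) = 0.
Proof.
transitivity (((dmx c (curv a b) + Gam c *m curv a b - curv a b *m Gam c) +
  (dmx a (curv b c) + Gam a *m curv b c - curv b c *m Gam a) +
  (dmx b (curv c a) + Gam b *m curv c a - curv c a *m Gam b)) *m G').
  rewrite /cov /rcurv !(dmxM, compat_inv) !(mulmxDl, mulmxDr, mulmxN, mulNmx).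
  rewrite !mulmxA; mx_abel.
by rewrite curv_bianchi mul0mx.
Qed.

(* Ricci with its second index raised. *)
Definition ric b e : S := \sum_a rcurv a b a e.
Definition scal : S := \sum_a \sum_b rcurv a b a b.
(** Covariant divergence of a mixed tensor: the first index is lower, and the upper one is
    contracted with the derivative. *)
Definition diver (h : 'I_n -> 'I_n -> S) c : S :=
  \sum_a d a (h c a) + \sum_a \sum_e Gam a a e * h c e
  - \sum_a \sum_e Gam c a e * h a e.

Lemma rcurv_swap a b i j : rcurv a b i j = - rcurv a b j i.
Proof. by have /matrixP/(_ j i) := rcurvT a b; rewrite !mxE. Qed.

Lemma rcurv_swap2 a b i j : rcurv a b i j = rcurv b a j i.
Proof. by rewrite rcurv_swap rcurvN mxE opprK. Qed.

Lemma covE c (E : 'M[S]_n) i j : cov c E i j =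
  d c (E i j) + \sum_e Gam c i e * E e j + \sum_e Gam c j e * E i e.
Proof.
rewrite /cov !mxE; congr (_ + _ + _).
by apply: eq_bigr => e _; rewrite mxE mulrC.
Qed.


Hypothesis two_reg : forall x : S, x + x = 0 -> x = 0.

Lemma sum_sym_antisym (s t : 'I_n -> 'I_n -> S) :
  (forall i j, s i j = s j i) -> (forall i j, t i j = - t j i) ->
  \sum_i \sum_j s i j * t i j = 0.
Proof.
move=> ss tt; apply: two_reg; rewrite {2}exchange_big -big_split big1 // => i _.
rewrite -big_split big1 // => j _ /=; rewrite ss (tt i j); ring.
Qed.

Lemma sum_rcurv_ric a e : \sum_b rcurv a b e b = ric a e.
Proof. by apply: eq_bigr => b _; rewrite rcurv_swap2. Qed.

(** A full covariant derivative of the contraction would be [d c scal]. The surplus comes from the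
    uncorrected form indices: each of the two upper indices contributes one copy of the contraction
    of [Gam c] with [ric]. *)
Lemma sum_cov_scal c : \sum_a \sum_b cov c (rcurv a b) a b =
  d c scal + (\sum_a \sum_e Gam c a e * ric a e) *+ 2.
Proof.
under eq_bigr => a _ do under eq_bigr => b _ do rewrite covE.
under eq_bigr => a _ do rewrite !big_split /=.
rewrite !big_split /= mulr2n addrA; congr (_ + _ + _).
- by rewrite d_sum; apply: eq_bigr => a _; rewrite d_sum.
- apply: eq_bigr => a _; rewrite exchange_big; apply: eq_bigr => e _.
  by rewrite -sum_rcurv_ric mulr_sumr.
- rewrite exchange_big; apply: eq_bigr => a _; rewrite exchange_big.
  by apply: eq_bigr => e _; rewrite /ric mulr_sumr.
Qed.

(** The Christoffel term on the second upper index drops out, being symmetric by torsion-freeness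
    and contracted with an antisymmetric pair of [rcurv]. *)
Lemma sum_cov_ric c : \sum_a \sum_b cov a (rcurv b c) a b =
  - (\sum_a d a (ric c a) + \sum_a \sum_e Gam a a e * ric c e).
Proof.
have ricN a : \sum_b rcurv b c a b = - ric c a.
  by rewrite -sum_rcurv_ric -sumrN; apply: eq_bigr => b _; rewrite rcurvN mxE.
under eq_bigr => a _ do under eq_bigr => b _ do rewrite covE.
under eq_bigr => a _ do rewrite !big_split /=.
rewrite !big_split /= opprD -!sumrN -[RHS]addr0; congr (_ + _ + _).
- by apply: eq_bigr => a _; rewrite -d_sum ricN d_opp.
- apply: eq_bigr => a _; rewrite exchange_big -sumrN; apply: eq_bigr => e _.
  by rewrite -mulr_sumr ricN mulrN.
- rewrite exchange_big big1 // => b _ /=.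
  under eq_bigr => a _ do under eq_bigr => e _ do rewrite torsion_free.
  apply: (@sum_sym_antisym (fun a e => Gam e b a) (fun a e => rcurv b c a e)).
    by move=> i j; rewrite torsion_free.
  by move=> i j; rewrite rcurv_swap.
Qed.

(** Trace the cyclic identity over both index pairs. Its last two terms agree, and the surplus of
    [sum_cov_scal] supplies exactly the lower-index correction of the divergence, twice. *)
Lemma contracted_bianchi c : d c scal = diver ric c *+ 2.
Proof.
have : \sum_a \sum_b cov c (rcurv a b) a b + \sum_a \sum_b cov a (rcurv b c) a b
    + \sum_a \sum_b cov b (rcurv c a) a b = 0.
  rewrite -!big_split big1 // => a _; rewrite -!big_split big1 // => b _ /=.
  by rewrite -!addmxE rcurv_bianchi mxE.
rewrite sum_cov_scal sum_cov_ric.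
(* Exchange [a] and [b], and use antisymmetry in both pairs at once. *)
have -> : \sum_a \sum_b cov b (rcurv c a) a b = \sum_a \sum_b cov a (rcurv b c) a b.
  rewrite exchange_big; apply: eq_bigr => a _; apply: eq_bigr => b _.
  rewrite !covE rcurv_swap2 addrAC; congr (_ + _ + _).
    by apply: eq_bigr => e _; rewrite rcurv_swap2.
  by apply: eq_bigr => e _; rewrite rcurv_swap2.
rewrite sum_cov_ric /diver => E; apply: subr0_eq; rewrite -[RHS]E; ring.
Qed.

(** * Covariant derivatives of a vector field and the soliton equation *)

Variable X : 'cV[S]_n.
Definition dcov a : 'cV[S]_n := dmx a X + Gam a *m X.

Lemma dcovE a k : dcov a k 0 = d a (X k 0) + \sum_e Gam a k e * X e 0.
Proof. by rewrite addmxE dmxE mxE. Qed.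

Lemma dcov_comm b c :
  (dmx c (dcov b) + Gam c *m dcov b) - (dmx b (dcov c) + Gam b *m dcov c) =
  curv c b *m X.
Proof.
rewrite /dcov /curv !(dmxD, dmxN, dmxM) !(mulmxDl, mulmxDr, mulmxN, mulNmx).
rewrite !mulmxA (dmxC c b); mx_abel.
Qed.

(** The trace of the Ricci identity [dcov_comm]; the curvature term is [Ric(d_b, X)]. *)
Lemma diver_dcov b : diver (fun a k => dcov a k 0) b =
  d b (\sum_a dcov a a 0) + \sum_c (curv c b *m X) c 0.
Proof.
have -> : \sum_c (curv c b *m X) c 0 =
    \sum_c (d c (dcov b c 0) + \sum_e Gam c c e * dcov b e 0
            - (d b (dcov c c 0) + \sum_e Gam b c e * dcov c e 0)).
  by apply: eq_bigr => c _; rewrite -dcov_comm !(addmxE, oppmxE) !mxE.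
by rewrite sumrB !big_split /= -d_sum /diver; ring.
Qed.

Variables u lambda : S.
Hypothesis d_lambda : forall a, d a lambda = 0.
Hypothesis gradientE : forall a, (G *m X) a 0 = d a u.

(** Because [G] is parallel, lowering the index of the covariant derivative of the gradient gives
    the covariant derivative of [du]. *)
Lemma hessE a b :
  (G *m dcov a) b 0 = d a (d b u) - \sum_k Gam a k b * d k u.
Proof.
have -> : G *m dcov a = dmx a (G *m X) - (Gam a)^T *m (G *m X).
  by rewrite /dcov dmxM compat mulmxDl mulmxDr !mulmxA; mx_abel.
rewrite addmxE oppmxE dmxE gradientE mxE; congr (_ - _).
by apply: eq_bigr => k _; rewrite mxE gradientE.
Qed.

Hypothesis soliton : forall a b,
  d a (d b u) - \sum_k Gam a k b * d k u + \sum_e curv e a e b = lambda * G a b.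

Lemma mixed_soliton a k :
  dcov a k 0 + ric a k = if a == k then lambda else 0.
Proof.
transitivity (\sum_c (lambda * G a c) * G' c k); last first.
  transitivity (lambda * (G *m G') a k).
    by rewrite mxE mulr_sumr; apply: eq_bigr => c _; rewrite mulrA.
  by rewrite GG' mxE; case: eqP => _; rewrite ?mulr1 ?mulr0.
under eq_bigr => c _ do rewrite -soliton -hessE mulrDl.
rewrite big_split /=; congr (_ + _).
  transitivity ((G' *m (G *m dcov a)) k 0); first by rewrite mulmxA G'G mul1mx.
  by rewrite mxE; apply: eq_bigr => c _; rewrite -{1}G'sym mxE mulrC.
rewrite /ric; under [RHS]eq_bigr => c _ do rewrite mulr_suml.
by rewrite exchange_big; apply: eq_bigr => e _; rewrite mxE.
Qed.

(** By [mixed_soliton] this is the divergence of [lambda] times the identity tensor. The derivative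
    terms vanish, and the two Christoffel contractions cancel by torsion-freeness. *)
Lemma diver_soliton b :
  diver (fun a k => dcov a k 0) b + diver ric b = 0.
Proof.
transitivity (diver (fun a k => if a == k then lambda else 0) b).
  rewrite /diver.
  under [in RHS]eq_bigr => a _ do rewrite -mixed_soliton dD.
  under [X in _ = _ + X - _]eq_bigr => a _ do
    (under eq_bigr => e _ do rewrite -mixed_soliton mulrDr; rewrite big_split /=).
  under [X in _ = _ - X]eq_bigr => a _ do
    (under eq_bigr => e _ do rewrite -mixed_soliton mulrDr; rewrite big_split /=).
  rewrite !big_split /=; ring.
rewrite /diver big1 ?add0r; last first.
  by move=> a _; case: ifP; rewrite ?d_lambda ?d_0.
rewrite -sumrB big1 // => a _.
rewrite (bigD1 b) //= eqxx big1 ?addr0; last first.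
  by move=> e /negPf; rewrite eq_sym => ->; rewrite mulr0.
rewrite (bigD1 a) //= eqxx big1 ?addr0; last first.
  by move=> e /negPf; rewrite eq_sym => ->; rewrite mulr0.
by rewrite torsion_free subrr.
Qed.


Lemma tr_dcov : \sum_a dcov a a 0 = \sum_(a < n) lambda - scal.
Proof.
rewrite /scal exchange_big -sumrB; apply: eq_bigr => a _.
by have := mixed_soliton a a; rewrite eqxx => <-; rewrite addrK.
Qed.

(** In [diver_soliton] the Hessian part is [Ric(d_b, X) - d b scal], and the Ricci part is half of
    [d b scal]. The identity is doubled so that no division occurs in the ring. *)
Lemma d_scal b : d b scal = (\sum_c (curv c b *m X) c 0) *+ 2.
Proof.
have := diver_soliton b; rewrite diver_dcov tr_dcov dD d_opp d_sum.
rewrite big1 => [|a _]; last exact: d_lambda.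
move=> /(congr1 (fun x => x *+ 2)); rewrite mul0rn mulrnDl -contracted_bianchi.
by move=> E; apply/esym/subr0_eq; rewrite -[RHS]E; ring.
Qed.

(** Metric compatibility gives twice the Hessian applied to [d_b] and [X]; the soliton equation
    replaces the Hessian by [lambda G - Ric], and [d_scal] identifies the Ricci term. *)
Lemma d_normX b : d b ((X^T *m G *m X) 0 0) = lambda * d b u *+ 2 - d b scal.
Proof.
have -> : d b ((X^T *m G *m X) 0 0) = ((G *m X)^T *m dcov b) 0 0 *+ 2.
  rewrite -dmxE mulr2n.
  have {1}-> : ((G *m X)^T *m dcov b) 0 0 = ((dcov b)^T *m G *m X) 0 0.
    transitivity (((G *m X)^T *m dcov b)^T 0 0); first by rewrite [RHS]mxE.
    by rewrite trmx_mul trmxK mulmxA.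
  rewrite -addmxE; congr (fun_of_matrix _ 0 0).
  rewrite !dmxM compat trmx_mul Gsym dmxT /dcov trmxD trmx_mul.
  by rewrite !(mulmxDl, mulmxDr) !mulmxA; mx_abel.
rewrite d_scal -mulrnBl mxE; congr (_ *+ 2).
transitivity (\sum_k d k u * ((if b == k then lambda else 0) - ric b k)).
  by apply: eq_bigr => k _; rewrite -mixed_soliton addrK mxE gradientE.
under eq_bigr => k _ do rewrite mulrBr.
rewrite sumrB (bigD1 b) //= eqxx big1 ?addr0 => [|k /negPf]; last first.
  by rewrite eq_sym => ->; rewrite mulr0.
rewrite mulrC; congr (_ - _).
rewrite /ric; under eq_bigr => k _ do rewrite mulr_sumr.
rewrite exchange_big; apply: eq_bigr => c _.
transitivity ((rcurv c b *m (G *m X)) c 0).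
  by rewrite [RHS]mxE; apply: eq_bigr => k _; rewrite gradientE mulrC.
by rewrite /rcurv -mulmxA (mulmxA G') G'G mul1mx.
Qed.

Lemma hamilton_identity b :
  d b ((X^T *m G *m X) 0 0 - \sum_a dcov a a 0 - lambda * u *+ 2) = 0.
Proof.
have dn : d b (\sum_(a < n) lambda) = 0.
  by rewrite d_sum big1 // => a _; exact: d_lambda.
rewrite tr_dcov !(dD, d_opp) dn d_normX.
rewrite !mulr2n ?dD !dM d_lambda; ring.
Qed.

End DifferentialRing.

(** * The Levi-Civita connection in matrix form *)

Section LeviCivita.
Variables (S : comPzRingType) (n : nat) (d : 'I_n -> S -> S).
Variables (G G' : 'M[S]_n) (half : S).
Hypothesis halfD : half + half = 1.
Hypothesis GG' : G *m G' = 1%:M.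
Hypothesis Gsym : G^T = G.
Hypothesis G'sym : G'^T = G'.

Definition levi_civita (a : 'I_n) : 'M[S]_n := \matrix_(k, c)
  (half * \sum_l G' k l * (d a (G c l) + d c (G a l) - d l (G a c))).

Lemma Gsymij i j : G i j = G j i.
Proof. by rewrite -{1}Gsym mxE. Qed.

Lemma levi_civita_torsion_free a k c : levi_civita a k c = levi_civita c k a.
Proof.
rewrite !mxE; congr (half * _); apply: eq_bigr => l _.
by rewrite [G c a]Gsymij; congr (_ * (_ - _)); rewrite addrC.
Qed.

(** Lowering the upper index gives the Christoffel symbols of the first kind, from which
    compatibility is read off without the inverse metric. *)
Lemma mul_levi_civita a b c : (G *m levi_civita a) b c =
  half * (d a (G c b) + d c (G a b) - d b (G a c)).
Proof.
pose K : 'cV[S]_n := \col_l (d a (G c l) + d c (G a l) - d l (G a c)).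
transitivity (half * (G *m (G' *m K)) b 0).
  rewrite !mxE mulr_sumr; apply: eq_bigr => k _; rewrite !mxE mulrCA.
  by congr (_ * (_ * _)); apply: eq_bigr => l _; rewrite !mxE.
by rewrite mulmxA GG' mul1mx mxE.
Qed.

Lemma levi_civita_compat a :
  dmx d a G = (levi_civita a)^T *m G + G *m levi_civita a.
Proof.
have -> : (levi_civita a)^T *m G = (G *m levi_civita a)^T.
  by rewrite trmx_mul Gsym.
apply/matrixP => b c; rewrite dmxE addmxE [(_^T) b c]mxE !mul_levi_civita.
rewrite [G c b]Gsymij -mulrDr.
transitivity ((half + half) * d a (G b c)); first by rewrite halfD mul1r.
ring.
Qed.

(** The logarithmic derivative of the volume density: the other two terms of the Christoffel symbol
    cancel by symmetry of [G] and [G']. Hence the divergence of a vector field needs no further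
    metric derivatives. *)
Lemma levi_civita_trace e : \sum_a levi_civita a a e =
  half * \sum_a \sum_l G' a l * d e (G l a).
Proof.
have E : \sum_a \sum_l G' a l * d a (G e l) = \sum_a \sum_l G' a l * d l (G a e).
  rewrite exchange_big; apply: eq_bigr => a _; apply: eq_bigr => l _.
  by rewrite -{1}G'sym mxE [G e a]Gsymij.
under eq_bigr => a _ do rewrite mxE.
rewrite -mulr_sumr; congr (_ * _).
transitivity (\sum_a \sum_l G' a l * d a (G e l) + \sum_a \sum_l G' a l * d e (G l a)
   - \sum_a \sum_l G' a l * d l (G a e)).
  rewrite -!sumrN -!big_split; apply: eq_bigr => a _.
  rewrite -!sumrN -!big_split; apply: eq_bigr => l _ /=.
  by rewrite [G l a]Gsymij; ring.
by rewrite E addrAC subrr add0r.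
Qed.

End LeviCivita.

(** * Positive definite matrices and change of coordinates for divergences *)

Section Divergence.
Variables (F : fieldType) (n : nat).
Variables (J H : 'M[F]_n) (DJ DG DH : 'I_n -> 'M[F]_n).
Variables (X : 'cV[F]_n) (DX DY : 'I_n -> 'cV[F]_n).
Hypothesis two_unit : (2 : F) != 0.
Hypotheses (Junit : J \in unitmx) (Hunit : H \in unitmx).
Hypothesis DGE : forall e, DG e = DJ e *m H *m J^T
  + J *m (\sum_m J e m *: DH m) *m J^T + J *m H *m (DJ e)^T.
Hypothesis DYE : forall a, \sum_m J a m *: DY m = (DJ a)^T *m X + J^T *m DX a.
Hypothesis DJC : forall a b k, DJ a b k = DJ b a k.

(** At a point, [J] is the Jacobian of a coordinate change, [H] the metric in the new chart, and [X]
    and its image [J^T *m X] a vector field in the two charts; the prefix [D] marks partial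
    derivatives in the respective coordinates. The identity is the derivative of [log det (J H J^T)
    = 2 log |det J| + log det H]. *)
Lemma tr_pullback_metric e : \tr (invmx (J *m H *m J^T) *m DG e) =
  2 * \tr (invmx J *m DJ e) + \sum_m J e m * \tr (invmx H *m DH m).
Proof.
have JTu : J^T \in unitmx by rewrite unitmx_tr.
have -> : invmx (J *m H *m J^T) = invmx J^T *m invmx H *m invmx J.
  have JHu : J *m H \in unitmx by rewrite unitmx_mul Junit.
  have u : J *m H *m J^T \in unitmx by rewrite unitmx_mul JHu.
  apply: (can_inj (mulKmx u)); rewrite mulmxV //.
  by rewrite !mulmxA (mulmxK JTu) (mulmxK Hunit) mulmxV.
rewrite DGE !mulmxDr !raddfD /=.
have t1 : \tr (invmx J^T *m invmx H *m invmx J *m (DJ e *m H *m J^T)) =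
    \tr (invmx J *m DJ e).
  rewrite -!mulmxA mxtrace_mulC !mulmxA (mulmxK JTu) mxtrace_mulC !mulmxA.
  by rewrite mulmxV // mul1mx.
have t2 : \tr (invmx J^T *m invmx H *m invmx J *m (J *m H *m (DJ e)^T)) =
    \tr (invmx J *m DJ e).
  rewrite !mulmxA (mulmxKV Junit) (mulmxKV Hunit) -mxtrace_tr trmx_mul trmxK.
  by rewrite trmx_inv trmxK mxtrace_mulC.
have t3 : \tr (invmx J^T *m invmx H *m invmx J *m (J *m (\sum_m J e m *: DH m) *m J^T)) =
    \sum_m J e m * \tr (invmx H *m DH m).
  rewrite !mulmxA (mulmxKV Junit) mxtrace_mulC !mulmxA mulmxV // mul1mx.
  rewrite mulmx_sumr raddf_sum /=; apply: eq_bigr => m _.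
  by rewrite -scalemxAr mxtraceZ.
by rewrite t1 t2 t3; ring.
Qed.

(** Both sides pick up the same Jacobian term, the trace of [invmx J *m DJ b] weighted by [X b 0]:
    one from the volume density, the other from differentiating [J^T *m X]. Matching them uses the
    symmetry [DJC] of second derivatives. *)
Lemma divergence_invariant :
  \sum_a DX a a 0 + 2^-1 * \sum_e \tr (invmx (J *m H *m J^T) *m DG e) * X e 0 =
  \sum_k DY k k 0 + 2^-1 * \sum_m \tr (invmx H *m DH m) * (J^T *m X) m 0.
Proof.
have -> : \sum_k DY k k 0 =
    \sum_a DX a a 0 + \sum_b \tr (invmx J *m DJ b) * X b 0.
  have DYk k : DY k = \sum_a invmx J k a *: ((DJ a)^T *m X + J^T *m DX a).
    under eq_bigr => a _ do rewrite -DYE scaler_sumr.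
    rewrite exchange_big /=; under eq_bigr => m _ do
      (under eq_bigr => a _ do rewrite scalerA; rewrite -scaler_suml).
    have E m : \sum_a invmx J k a * J a m = (k == m)%:R.
      by have := congr1 (fun B => fun_of_matrix B k m) (mulVmx Junit); rewrite !mxE.
    rewrite (bigD1 k) //= E eqxx scale1r big1 ?addr0 // => m /negPf mk.
    by rewrite E eq_sym mk scale0r.
  under eq_bigr => k _ do rewrite DYk summxE.
  rewrite exchange_big /=.
  under eq_bigr => a _ do (under eq_bigr => k _ do rewrite mxE mxE mulrDr;
    rewrite big_split /=).
  rewrite big_split /= addrC; congr (_ + _).
    apply: eq_bigr => a _.
    transitivity (((invmx J)^T *m (J^T *m DX a)) a 0).
      by rewrite mxE; apply: eq_bigr => k _; rewrite [in RHS]mxE.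
    by rewrite mulmxA -trmx_mul mulmxV // trmx1 mul1mx.
  transitivity (\sum_a \sum_k \sum_b invmx J k a * DJ b a k * X b 0).
    apply: eq_bigr => a _; apply: eq_bigr => k _; rewrite mxE mulr_sumr.
    by apply: eq_bigr => b _; rewrite mxE mulrA DJC.
  rewrite exchange_big /=; under eq_bigr => k _ do rewrite exchange_big /=.
  rewrite exchange_big /=; apply: eq_bigr => b _.
  rewrite /mxtrace mulr_suml; apply: eq_bigr => k _.
  by rewrite mxE mulr_suml.
rewrite -addrA; congr (_ + _).
under eq_bigr => e _ do rewrite tr_pullback_metric mulrDl -mulrA.
rewrite big_split /= -mulr_sumr mulrDr mulrA mulVf // mul1r; congr (_ + _ * _).
under eq_bigr => e _ do rewrite mulr_suml.
rewrite exchange_big /=; apply: eq_bigr => m _.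
rewrite mxE mulr_sumr; apply: eq_bigr => e _; rewrite mxE; ring.
Qed.

End Divergence.

(** * Factorization of positive definite matrices and a trace bound *)

Section PositiveDefinite.
Variable R : rcfType.

Definition posdef n (A : 'M[R]_n) :=
  A^T = A /\ forall v : 'rV[R]_n, v != 0 -> 0 < (v *m A *m v^T) 0 0.

Lemma posdef_unit n (A : 'M[R]_n) : posdef A -> A \in unitmx.
Proof.
move=> [_ pA]; rewrite -row_free_unit -kermx_eq0; apply/negPn/negP => /rowV0Pn[v].
by move=> /sub_kermxP vA /pA; rewrite vA mul0mx mxE ltxx.
Qed.

Lemma posdef_inv n (A : 'M[R]_n) : posdef A -> posdef (invmx A).
Proof.
move=> pA; have uA := posdef_unit pA; have [sA p] := pA.
split=> [|v v0]; first by rewrite trmx_inv sA.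
have := p (v *m invmx A); rewrite mulmxKV // trmx_mul trmx_inv sA mulmxA; apply.
by apply: contraNneq v0 => vA; rewrite -(mulmxKV uA v) vA mul0mx.
Qed.

(* Cholesky: the induction step passes to the Schur complement. *)
Lemma posdef_sqr n (A : 'M[R]_n) : posdef A -> exists P : 'M[R]_n, A = P *m P^T.
Proof.
elim: n A => [|n IH] A [sA pA].
  by exists 0; apply/matrixP => -[].
rewrite -[n.+1]/(1 + n)%N in A sA pA *.
pose a := A 0 0; pose b : 'cV[R]_n := dlsubmx A; pose D : 'M[R]_n := drsubmx A.
have AE : A = block_mx a%:M b^T b D.
  rewrite -[LHS]submxK /b /D; congr block_mx.
    by apply/matrixP => i j; rewrite !ord1 !mxE /= /a; congr (A _ _); apply: val_inj.
  by rewrite trmx_dlsub sA.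
have a0 : 0 < a.
  have := pA (row_mx 1 0); rewrite AE tr_row_mx mul_row_block mul_row_col.
  rewrite !mul0mx !addr0 !mul1mx trmx1 trmx0 mulmx1 mulmx0 addr0 mxE; apply.
  apply/negP => /eqP/(congr1 (fun B : 'rV[R]_(1 + n) => lsubmx B 0 0)).
  by rewrite row_mxKl !mxE => /eqP; rewrite oner_eq0.
have sD : D^T = D by rewrite /D trmx_drsub sA.
pose S := D - a^-1 *: (b *m b^T).
have [P SP] : exists P : 'M[R]_n, S = P *m P^T.
  apply: IH; split=> [|w w0].
    by rewrite /S linearB /= linearZ /= trmx_mul trmxK sD.
  (* The first block minimises the quadratic form for fixed [w]: the first block of the product with
     [A] vanishes, and the value left is that of the Schur complement at [w]. *)
  have := pA (row_mx (- a^-1 *: (w *m b)) w); rewrite AE tr_row_mx mul_row_block.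
  rewrite mul_row_col linearZ /= trmx_mul.
  have -> : - a^-1 *: (w *m b) *m a%:M + w *m b = 0.
    by rewrite mul_mx_scalar scalerA mulrN divff ?gt_eqF // scaleN1r addNr.
  have nz : row_mx (- a^-1 *: (w *m b)) w != 0.
    apply: contra w0 => /eqP/(congr1 (@rsubmx R 1 1 n)); rewrite row_mxKr => ->.
    by apply/eqP/matrixP => i j; rewrite !mxE.
  rewrite mul0mx add0r /S => /(_ nz); rewrite mulmxBr mulmxBl.
  by rewrite mulmxDl addrC -!scalemxAl -!scalemxAr -scalemxAl !mulmxA scaleNr.
pose s := Num.sqrt a.
have ss : s * s = a by rewrite -expr2 sqr_sqrtr // ltW.
have s0 : s != 0 by rewrite gt_eqF // sqrtr_gt0.
exists (block_mx s%:M 0 (s^-1 *: b) P).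
rewrite tr_block_mx mulmx_block AE !trmx0 !mulmx0 !mul0mx !addr0 tr_scalar_mx.
rewrite -scalar_mxM ss linearZ /= mul_scalar_mx mul_mx_scalar !scalerA mulfV //.
rewrite !scale1r -SP /S -scalemxAl -scalemxAr scalerA -invfM ss; congr block_mx.
by rewrite addrC subrK.
Qed.

(** With [A] the inverse metric and [A = P *m P^T], the matrix [M] is [T] in an orthonormal frame.
    The fourfold sum is its squared Frobenius norm, which dominates every [M i i ^+ 2]; the trace
    has [n] such terms. *)
Lemma tr_bound n (A T : 'M[R]_n) (K : R) : posdef A ->
  Num.sqrt (\sum_a \sum_b \sum_c \sum_d A a c * A b d * T a b * T c d) <= K ->
  `|\sum_a \sum_b T a b * A b a| <= K *+ n.
Proof.
move=> pA; have [P AP] := posdef_sqr pA; have [sA _] := pA.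
pose M := P^T *m T *m P.
have -> : \sum_a \sum_b \sum_c \sum_d A a c * A b d * T a b * T c d
    = \sum_i \sum_j M i j ^+ 2.
  transitivity (\tr ((T^T *m A) *m (T *m A))).
    rewrite /mxtrace; under [RHS]eq_bigr => b _ do rewrite mxE.
    rewrite [RHS]exchange_big /=.
    under [LHS]eq_bigr => a _ do rewrite exchange_big /=.
    rewrite exchange_big /=; apply: eq_bigr => c _.
    rewrite exchange_big /=; apply: eq_bigr => b _.
    rewrite !mxE mulr_suml; apply: eq_bigr => a _.
    rewrite mulr_sumr; apply: eq_bigr => d _.
    by rewrite mxE -[in A b d]sA mxE; ring.
  transitivity (\tr (M^T *m M)).
    by rewrite /M AP !trmx_mul trmxK !mulmxA mxtrace_mulC !mulmxA.
  rewrite exchange_big; apply: eq_bigr => j _; rewrite mxE.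
  by apply: eq_bigr => i _; rewrite mxE expr2.
have -> : \sum_a \sum_b T a b * A b a = \sum_i M i i.
  transitivity (\tr (T *m A)).
    by rewrite /mxtrace; apply: eq_bigr => a _; rewrite mxE.
  by rewrite AP mulmxA mxtrace_mulC mulmxA.
move=> sK; apply: le_trans (ler_norm_sum _ _ _) _.
rewrite -[n in K *+ n]card_ord -sumr_const; apply: ler_sum => i _.
apply: le_trans sK; rewrite -sqrtr_sqr ler_sqrt; last first.
  by rewrite !sumr_ge0 // => ? _; rewrite sumr_ge0 // => ? _; rewrite sqr_ge0.
rewrite (bigD1 i) //= (bigD1 i) //= -addrA lerDl addr_ge0 ?sumr_ge0 // => j _.
  exact: sqr_ge0.
by rewrite sumr_ge0 // => k _; exact: sqr_ge0.
Qed.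

End PositiveDefinite.

(** * Calculus with partial derivatives *)

Local Open Scope classical_set_scope.
Local Open Scope ring_scope.

Lemma add_thirds_lt (R : realFieldType) (r : R) : 0 < r -> r / 3 + r / 3 < r.
Proof. lra. Qed.

Lemma subr_swap (V : zmodType) (p q r s : V) : p - q - (r - s) = p - r - (q - s).
Proof. by rewrite !opprB !addrA [LHS]addrAC [RHS]addrAC (addrAC p). Qed.

Section Calculus.
Context {R : realType} {n : nat}.
Implicit Types (U : set 'rV[R]_n) (f g : 'rV[R]_n -> R) (x y : 'rV[R]_n).
Implicit Types a b : 'I_n.

Local Notation e_ a := (delta_mx 0 a : 'rV[R]_n).

Lemma nbhs_box x (P : set 'rV[R]_n) : nbhs x P ->
  exists2 r : R, 0 < r & forall y, (forall k, `|y 0 k - x 0 k| < r) -> P y.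
Proof.
move=> /nbhs_ballP[r r0 rP]; exists r => // y xy; apply: rP; split => // i j.
by rewrite ord1 /ball /= distrC; exact: xy.
Qed.

Lemma near_open U x (P : 'rV[R]_n -> Prop) :
  open U -> U x -> (forall y, U y -> P y) -> \forall y \near x, P y.
Proof. by move=> oU Ux UP; apply: filterS (open_nbhs_nbhs (conj oU Ux)). Qed.

Lemma is_derive_line f x a t : derivable f (x + t *: e_ a) (e_ a) ->
  is_derive t 1 (fun s : R => f (x + s *: e_ a)) (pder a f (x + t *: e_ a)).
Proof.
have E : (fun h : R => h^-1 *: (((fun s : R => f (x + s *: e_ a)) \o shift t) (h *: 1) -
    f (x + t *: e_ a))) =
  (fun h : R => h^-1 *: ((f \o shift (x + t *: e_ a)) (h *: e_ a) - f (x + t *: e_ a))).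
  apply/funext => h /=; congr (_ *: (f _ - _)).
  by rewrite [h *: 1]mulr1 scalerDl addrCA.
by move=> df; split; rewrite /derivable /derive /pder /derive E.
Qed.

Lemma axis_mvt f x a (t : R) :
  (forall s : R, `|s| <= `|t| -> derivable f (x + s *: e_ a) (e_ a)) ->
  exists2 s, `|s| <= `|t| &
    f (x + t *: e_ a) - f x = t * pder a f (x + s *: e_ a).
Proof.
move=> df; pose g (s : R) := f (x + s *: e_ a).
have dg (s : R) : `|s| <= `|t| -> is_derive s 1 g (pder a f (x + s *: e_ a)).
  by move=> st; apply: is_derive_line; exact: df.
have g0 : g 0 = f x by rewrite /g scale0r addr0.
have gc (p q : R) : {in `[p, q], forall s, `|s| <= `|t|} ->
    {within `[p, q], continuous g}.
  move=> pq; apply: (@derivable_within_continuous _ _ g `[p, q]) => s spq.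
  by have ? := dg s (pq s spq); exact: ex_derive.
have [t0|t0|->] := ltgtP t 0.
- have st (s : R) : s \in `[t, 0] -> `|s| <= `|t|.
    by rewrite in_itv /= => /andP[ts s0]; rewrite !ler0_norm ?lerN2 // ltW.
  have [s st0 gE] := MVT t0 (fun s sI => dg s (st s (subset_itv_oo_cc sI))) (gc _ _ st).
  exists s; first by apply: st; exact: subset_itv_oo_cc.
  by rewrite -g0 -/(g t) -opprB gE; ring.
- have st (s : R) : s \in `[0, t] -> `|s| <= `|t|.
    by rewrite in_itv /= => /andP[ts s0]; rewrite !ger0_norm // ltW.
  have [s st0 gE] := MVT t0 (fun s sI => dg s (st s (subset_itv_oo_cc sI))) (gc _ _ st).
  exists s; first by apply: st; exact: subset_itv_oo_cc.
  by rewrite -g0 -/(g t) gE; ring.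
- by exists 0 => //; rewrite scale0r addr0 subrr mul0r.
Qed.

Lemma rowDeE x a t k : (x + t *: e_ a) 0 k = x 0 k + (if k == a then t else 0).
Proof. by rewrite !mxE eqxx /=; case: eqP => _; rewrite ?mulr1 ?mulr0. Qed.

(* The path from [x] to [y] follows the coordinate axes one after the other. *)
Lemma box_mvt f x y :
  (forall z : 'rV[R]_n, (forall k, `|z 0 k - x 0 k| <= `|y 0 k - x 0 k|) ->
    forall a, derivable f z (e_ a)) ->
  exists2 xi : 'I_n -> 'rV[R]_n,
    (forall j k, `|xi j 0 k - x 0 k| <= `|y 0 k - x 0 k|) &
    f y - f x = \sum_j (y 0 j - x 0 j) * pder j f (xi j).
Proof.
move=> df; pose z (j : nat) : 'rV[R]_n := \row_k (if (k < j)%N then y 0 k else x 0 k).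
have zS (j : 'I_n) : z j.+1 = z j + (y 0 j - x 0 j) *: e_ j.
  apply/rowP => k; rewrite rowDeE !mxE ltnS leq_eqVlt -val_eqE /=.
  case: (ltngtP k j) => [||/val_inj ->] /=; rewrite ?addr0 //.
  by rewrite addrC subrK.
have zin (j : 'I_n) (s : R) : `|s| <= `|y 0 j - x 0 j| ->
    forall k, `|(z j + s *: e_ j) 0 k - x 0 k| <= `|y 0 k - x 0 k|.
  move=> sj k; rewrite rowDeE mxE; case: eqP => [->|_].
    by rewrite ltnn addrC addKr.
  by rewrite addr0; case: ifP => // _; rewrite subrr normr0.
have /choice[s sP] (j : 'I_n) : exists s : R, `|s| <= `|y 0 j - x 0 j| /\
    f (z j.+1) - f (z j) = (y 0 j - x 0 j) * pder j f (z j + s *: e_ j).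
  have [s s1 s2] := axis_mvt (fun s sj => df _ (zin j s sj) j).
  by exists s; rewrite zS.
exists (fun j : 'I_n => z j + s j *: e_ j) => [j k|].
  by apply: zin; have [] := sP j.
have -> : y = z n by apply/rowP => k; rewrite mxE ltn_ord.
have {1}-> : x = z 0%N by apply/rowP => k; rewrite mxE ltn0.
rewrite -(telescope_sumr (fun j => f (z j)) (leq0n n)) big_mkord; apply: eq_bigr => j _.
by have [_ ->] := sP j; rewrite mxE ltn_ord.
Qed.

Lemma pder0_nbhs_cst U f x : open U -> U x ->
  (forall y, U y -> forall a, derivable f y (e_ a) /\ pder a f y = 0) ->
  \forall y \near x, f y = f x.
Proof.
move=> oU Ux df; have [r r0 rU] := nbhs_box (open_nbhs_nbhs (conj oU Ux)).
apply/nbhs_ballP; exists r => // y xy.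
have yr k : `|y 0 k - x 0 k| < r by have := xy.2 0 k; rewrite /ball /= distrC.
have inU (z : 'rV[R]_n) : (forall k, `|z 0 k - x 0 k| <= `|y 0 k - x 0 k|) -> U z.
  by move=> zy; apply: rU => k; apply: le_lt_trans (zy k) (yr k).
have [|xi xiP E] := @box_mvt f x y; first by move=> z /inU Uz a; have [] := df _ Uz a.
apply/subr0_eq; rewrite E big1 // => j _.
by have [_ ->] := df _ (inU _ (xiP j)) j; rewrite mulr0.
Qed.


Lemma is_derive_translate f x c v : derivable f (x + c) v ->
  is_derive x v (fun y => f (y + c)) ('D_v f (x + c)).
Proof.
have E : (fun h : R => h^-1 *: (((fun y => f (y + c)) \o shift x) (h *: v) - f (x + c))) =
  (fun h : R => h^-1 *: ((f \o shift (x + c)) (h *: v) - f (x + c))).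
  by apply/funext => h /=; rewrite addrA.
by move=> df; split; rewrite /derivable /derive E.
Qed.

(** Apply the mean value theorem along [a] to the increment of [f] in direction [b], then along [b]
    to [pder a f]. *)
Lemma second_difference f x a b (s : R) :
  (forall p q : R, `|p| <= `|s| -> `|q| <= `|s| ->
    derivable f (x + p *: e_ a + q *: e_ b) (e_ a) /\
    derivable (pder a f) (x + p *: e_ a + q *: e_ b) (e_ b)) ->
  exists p q : R, [/\ `|p| <= `|s|, `|q| <= `|s| &
    f (x + s *: e_ a + s *: e_ b) - f (x + s *: e_ a) - (f (x + s *: e_ b) - f x)
    = s * s * pder b (pder a f) (x + p *: e_ a + q *: e_ b)].
Proof.
move=> df; pose g := (fun y => f (y + s *: e_ b)) - f.
have dg p : `|p| <= `|s| -> is_derive (x + p *: e_ a) (e_ a) g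
    (pder a f (x + p *: e_ a + s *: e_ b) - pder a f (x + p *: e_ a)).
  move=> ps; have [d1 _] := df p s ps (lexx _).
  have [|d2 _] := df p 0 ps; first by rewrite normr0.
  rewrite scale0r addr0 in d2.
  have ? := is_derive_translate d1; have ? := derivableP d2.
  exact: is_deriveB.
have [p ps E] := @axis_mvt g x a s (fun p ps => @ex_derive _ _ _ _ _ _ _ (dg p ps)).
have [q qs E'] := @axis_mvt (pder a f) (x + p *: e_ a) b s
   (fun q qs => (df p q ps qs).2).
exists p, q; split => //.
transitivity (g (x + s *: e_ a) - g x) => //.
by rewrite E {1}/pder (@derive_val _ _ _ _ _ _ _ (dg p ps)) E' mulrA.
Qed.

(** * Functions of class C^k and symmetry of second derivatives *)

Lemma Ck_cont k U f x : Ck_on k U f -> U x -> {for x, continuous f}.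
Proof. by case: k => [|k] [fc _]; exact: fc. Qed.

Lemma Ck_derivable k U f x a : Ck_on k.+1 U f -> U x -> derivable f x (e_ a).
Proof. by move=> [_ df]; have [d _] := df a; exact: d. Qed.

Lemma Ck_pder k U f a : Ck_on k.+1 U f -> Ck_on k U (pder a f).
Proof. by move=> [_ df]; have [_ d] := df a. Qed.

Lemma Ck_onW k U f : Ck_on k.+1 U f -> Ck_on k U f.
Proof.
elim: k f => [|k IH] f fk; first by case: fk.
split=> [x|a]; first exact: Ck_cont fk.
split=> [x|]; first exact: Ck_derivable fk.
exact/IH/Ck_pder/fk.
Qed.

(** The second difference is symmetric in [a] and [b], so the two mixed derivatives take a common
    value at points arbitrarily near [x]. Continuity excludes a gap of [2 e] between them at [x]. *)
Lemma pderC U f x a b : open U -> Ck_on 2 U f -> U x ->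
  pder a (pder b f) x = pder b (pder a f) x.
Proof.
move=> oU f2 Ux; apply/eqP/negPn/negP => ab.
pose D a b := pder a (pder b f).
have Dc c d : {for x, continuous (D c d)}.
  exact: Ck_cont (Ck_pder c (Ck_pder d f2)) Ux.
pose e : R := `|D a b x - D b a x| / 2.
have e0 : 0 < e by rewrite divr_gt0 // normr_gt0 subr_eq0.
have nU : \forall y \near x, U y /\ (`|D a b x - D a b y| < e /\
    `|D b a x - D b a y| < e).
  have n1 c d : \forall y \near x, `|D c d x - D c d y| < e.
    by have /cvgrPdist_lt := Dc c d; apply.
  exact: filterI (open_nbhs_nbhs (conj oU Ux)) (filterI (n1 _ _) (n1 _ _)).
have [r r0 rP] := nbhs_box nU.
(* If [a = b], the two displacements add up in one coordinate, so [s + s < r] is required. *)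
pose s : R := r / 3.
have s0 : 0 < s by rewrite divr_gt0.
have inr (c d : 'I_n) (p q : R) : `|p| <= `|s| -> `|q| <= `|s| ->
    forall k, `|(x + p *: e_ c + q *: e_ d) 0 k - x 0 k| < r.
  move=> ps qs k; rewrite !rowDeE -(addrA (x 0 k)) addrC addKr.
  apply: le_lt_trans (ler_normD _ _) _.
  have bs (b0 : bool) (t : R) : `|t| <= `|s| -> `|if b0 then t else 0| <= s.
    by rewrite (gtr0_norm s0) => ts; case: b0 => //; rewrite normr0 ltW.
  apply: (@le_lt_trans _ _ (s + s)); first by rewrite lerD // bs.
  exact: add_thirds_lt.
have sd c d := @second_difference f x c d s (fun p q ps qs =>
  let Uy := (rP _ (inr c d p q ps qs)).1 in
  conj (Ck_derivable f2 Uy) (Ck_derivable (Ck_pder c f2) Uy)).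
have [p [q [ps qs E]]] := sd a b.
have [p' [q' [ps' qs' E']]] := sd b a.
have DE : D b a (x + p *: e_ a + q *: e_ b) = D a b (x + p' *: e_ b + q' *: e_ a).
  have ss0 : s * s != 0 by rewrite mulf_neq0 // gt_eqF.
  apply: (mulfI ss0).
  apply: etrans (esym E) _.
  apply: etrans _ E'.
  rewrite [x + s *: e_ b + s *: e_ a]addrAC.
  exact: subr_swap.
have [_ [_ l1]] := rP _ (inr a b p q ps qs).
have [_ [l2 _]] := rP _ (inr b a p' q' ps' qs').
have : `|D a b x - D b a x| < e + e.
  rewrite -(subrKA (D a b (x + p' *: e_ b + q' *: e_ a))).
  apply: le_lt_trans (ler_normD _ _) _; apply: ltrD; first exact: l2.
  by rewrite distrC -DE; exact: l1.
by rewrite /e -splitr ltxx.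
Qed.


Lemma near_eq_continuous f g x : (\forall y \near x, f y = g y) ->
  {for x, continuous f} -> {for x, continuous g}.
Proof.
move=> fg fc; have fgx : f x = g x := nbhs_singleton fg.
have : g @ x --> f x by exact: cvg_trans (near_eq_cvg fg) fc.
by rewrite fgx.
Qed.

Lemma Ck_on_ext k U f g : open U -> (forall x, U x -> f x = g x) ->
  Ck_on k U f -> Ck_on k U g.
Proof.
move=> oU; elim: k f g => [|k IH] f g fg [fc df].
  by split=> // x Ux; exact: near_eq_continuous (near_open oU Ux fg) (fc x Ux).
split=> [x Ux|a].
  exact: near_eq_continuous (near_open oU Ux fg) (fc x Ux).
have [d1 d2] := df a; split=> [x Ux|].
  exact: near_eq_derivable (near_open oU Ux fg) (d1 x Ux).
apply: IH d2 => x Ux; exact: near_eq_derive (near_open oU Ux fg).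
Qed.

Lemma Ck_on_cst k U (c : R) : Ck_on k U (cst c).
Proof.
elim: k c => [|k IH] c; first by split=> // x _; exact: cst_continuous.
split=> [x _|a]; first exact: cst_continuous.
split=> [x _|]; first exact: derivable_cst.
have -> : pder a (cst c : 'rV[R]_n -> R) = cst 0.
  by apply/funext => x; rewrite /pder derive_cst.
exact: IH.
Qed.

Lemma Ck_onD k U f g : open U -> Ck_on k U f -> Ck_on k U g -> Ck_on k U (f + g).
Proof.
move=> oU; elim: k f g => [|k IH] f g fk gk.
  split=> // x Ux; have fc := Ck_cont fk Ux; have gc := Ck_cont gk Ux.
  exact: continuousD fc gc.
split=> [x Ux|a].
  have fc := Ck_cont fk Ux; have gc := Ck_cont gk Ux.
  exact: continuousD fc gc.
split=> [x Ux|].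
  have fd := Ck_derivable (a := a) fk Ux; have gd := Ck_derivable (a := a) gk Ux.
  exact: derivableD fd gd.
apply: Ck_on_ext (IH _ _ (Ck_pder a fk) (Ck_pder a gk)) => // x Ux.
have fd := Ck_derivable (a := a) fk Ux; have gd := Ck_derivable (a := a) gk Ux.
by rewrite /pder (deriveD fd gd).
Qed.

Lemma Ck_onM k U f g : open U -> Ck_on k U f -> Ck_on k U g -> Ck_on k U (f * g).
Proof.
move=> oU; elim: k f g => [|k IH] f g fk gk.
  split=> // x Ux; have fc := Ck_cont fk Ux; have gc := Ck_cont gk Ux.
  exact: continuousM fc gc.
split=> [x Ux|a].
  have fc := Ck_cont fk Ux; have gc := Ck_cont gk Ux.
  exact: continuousM fc gc.
split=> [x Ux|].
  have fd := Ck_derivable (a := a) fk Ux; have gd := Ck_derivable (a := a) gk Ux.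
  exact: derivableM fd gd.
have := Ck_onD oU (IH _ _ (Ck_onW fk) (Ck_pder a gk))
                  (IH _ _ (Ck_onW gk) (Ck_pder a fk)).
apply: Ck_on_ext => // x Ux.
have fd := Ck_derivable (a := a) fk Ux; have gd := Ck_derivable (a := a) gk Ux.
by rewrite /pder (deriveM fd gd).
Qed.

Lemma Ck_onN k U f : open U -> Ck_on k U f -> Ck_on k U (- f).
Proof.
move=> oU /(Ck_onM oU (Ck_on_cst k U (-1))); apply: Ck_on_ext => // x _.
exact: mulN1r.
Qed.

Lemma Ck_onV k U f : open U -> (forall x, U x -> f x != 0) ->
  Ck_on k U f -> Ck_on k U (fun x => (f x)^-1).
Proof.
move=> oU f0; elim: k => [|k IH] fk.
  by split=> // x Ux; have fc := Ck_cont fk Ux; exact: continuousV (f0 x Ux) fc.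
split=> [x Ux|a].
  by have fc := Ck_cont fk Ux; exact: continuousV (f0 x Ux) fc.
split=> [x Ux|].
  by have fd := Ck_derivable (a := a) fk Ux; exact: derivableV (f0 x Ux) fd.
have fV := IH (Ck_onW fk).
have := Ck_onN oU (Ck_onM oU (Ck_onM oU fV fV) (Ck_pder a fk)).
apply: Ck_on_ext => // x Ux.
have fd := Ck_derivable (a := a) fk Ux; rewrite /pder (deriveV (f0 x Ux) fd).
by rewrite scaleNr -exprVn expr2.
Qed.

(** Only continuous partial derivatives are at hand, so the increment of [f] is expanded by
    [box_mvt] into coordinate increments times partial derivatives at intermediate points [xi].
    These points tend to [tau x], and the difference quotient converges term by term. *)
Lemma chain_rule U f (tau : 'rV[R]_n -> 'rV[R]_n) x v :
  open U -> Ck_on 1 U f -> U (tau x) ->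
  (forall k, derivable (fun y => tau y 0 k) x v) ->
  is_derive x v (f \o tau)
    (\sum_k 'D_v (fun y => tau y 0 k) x * pder k f (tau x)).
Proof.
move=> oU f1 Utx dtau.
pose T (h : R) := tau (h *: v + x).
have T0 : T 0 = tau x by rewrite /T scale0r add0r.
have nearT e : 0 < e -> \forall h \near (0 : R), forall k, `|T h 0 k - tau x 0 k| < e.
  move=> e0; apply: (filter_forall (nbhs_filter (0 : R))) => k.
  have /derivable1_diffP/differentiable_continuous := (derivable1P _ _ _).1 (dtau k).
  move=> /cvgrPdist_lt/(_ e e0); apply: filterS => h /=.
  by rewrite scale0r add0r distrC.
have [r r0 rU] := nbhs_box (open_nbhs_nbhs (conj oU Utx)).
have /choice[xi xiP] h : exists xi : 'I_n -> 'rV[R]_n,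
    (forall k, `|T h 0 k - tau x 0 k| < r) ->
    (forall j k, `|xi j 0 k - tau x 0 k| <= `|T h 0 k - tau x 0 k|) /\
    f (T h) - f (tau x) = \sum_j (T h 0 j - tau x 0 j) * pder j f (xi j).
  have [hr|hr] := pselect (forall k, `|T h 0 k - tau x 0 k| < r); last first.
    (* A dummy value when the point is too far away for the box to lie in [U]. *)
    by exists (fun=> 0) => /hr.
  have [|xi xi1 xi2] := @box_mvt f (tau x) (T h); last by exists xi.
  move=> z zh a; apply: Ck_derivable f1 _; apply: rU => k.
  exact: le_lt_trans (zh k) (hr k).
have pderT j : pder j f (xi h j) @[h --> (0 : R)] --> pder j f (tau x).
  apply/cvgrPdist_lt => e e0.
  have /cvgrPdist_lt/(_ e e0)/nbhs_box[d d0 dP] := Ck_cont (Ck_pder j f1) Utx.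
  near=> h; have hd : forall k, `|T h 0 k - tau x 0 k| < d by near: h; exact: nearT.
  have hr : forall k, `|T h 0 k - tau x 0 k| < r by near: h; exact: nearT.
  by apply: dP => k; exact: le_lt_trans ((xiP h hr).1 j k) (hd k).
have main : (fun h => h^-1 *: ((f \o tau \o shift x) (h *: v) - (f \o tau) x)) @ 0^' -->
    \sum_k 'D_v (fun y => tau y 0 k) x * pder k f (tau x).
  have : (fun h => \sum_k (h^-1 *: (T h 0 k - tau x 0 k)) * pder k f (xi h k)) @ 0^' -->
      \sum_k 'D_v (fun y => tau y 0 k) x * pder k f (tau x).
    apply: cvg_big => [|k _]; first exact: add_continuous.
    apply: cvgM; first exact: dtau.
    exact: cvg_trans (cvg_app _ (@nbhs_dnbhs _ _)) (pderT k).
  apply: cvg_trans; apply: near_eq_cvg.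
  have : \forall h \near 0^', forall k, `|T h 0 k - tau x 0 k| < r.
    exact: nbhs_dnbhs (nearT r r0).
  move=> nr; near=> h; have hr : forall k, `|T h 0 k - tau x 0 k| < r by near: h.
  have [_] := xiP h hr; rewrite /= -/(T h) => ->.
  by rewrite scaler_sumr; apply: eq_bigr => k _; rewrite /GRing.scale /= mulrA.
by split; [exact: cvgP main|exact: cvg_lim main].
Unshelve. all: by end_near.
Qed.

End Calculus.

(** * The differential ring of smooth functions on an open set *)

Section SmoothRing.
Context {R : realType} {n : nat} (U : set 'rV[R]_n) (oU : open U).

(* The proof of openness is an argument so that the subring structure, which
   depends on it, can be inferred from the predicate. *)
Definition smooth_pred (_ : open U) : {pred 'rV[R]_n -> R} :=
  fun f => `[< smooth_on U f >].

Lemma smooth_subring : subring_closed (smooth_pred oU).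
Proof.
split=> [|f g /asboolP fs /asboolP gs|f g /asboolP fs /asboolP gs];
  apply/asboolP => k; first exact: Ck_on_cst.
- by apply: Ck_onD => //; apply: Ck_onN.
- exact: Ck_onM.
Qed.

HB.instance Definition _ :=
  GRing.isSubringClosed.Build _ (smooth_pred oU) smooth_subring.

(** The elements are total functions, smooth on [U], and equality in the ring is equality
    everywhere; an identity therefore has to hold outside [U] too. *)
Record smooth_fct := SmoothFct {
  smooth_val :> 'rV[R]_n -> R;
  _ : smooth_val \in smooth_pred oU }.

HB.instance Definition _ := [isSub of smooth_fct for smooth_val].
HB.instance Definition _ := [Choice of smooth_fct by <:].
HB.instance Definition _ :=
  GRing.SubChoice_isSubComPzRing.Build _ _ smooth_fct (GRing.subringClosedP _).

Lemma smooth_fctP (f : smooth_fct) : smooth_on U f.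
Proof. by case: f => f /= /asboolP. Qed.

Definition to_smooth (f : 'rV[R]_n -> R) (fs : smooth_on U f) : smooth_fct :=
  SmoothFct (asboolT fs).

(* Cut off outside [U], where [pder] need not satisfy the Leibniz rule. *)
Definition cut_pder (a : 'I_n) (f : smooth_fct) : 'rV[R]_n -> R :=
  fun x => if `[< U x >] then pder a f x else 0.

Lemma cut_pderE a f x : U x -> cut_pder a f x = pder a f x.
Proof. by rewrite /cut_pder => /asboolT ->. Qed.

Lemma cut_pder_smooth a f : smooth_on U (cut_pder a f).
Proof.
move=> k; apply: Ck_on_ext (Ck_pder a (smooth_fctP f k.+1)) => // x Ux.
by rewrite cut_pderE.
Qed.

Definition dsm a f : smooth_fct := to_smooth (cut_pder_smooth a f).

Lemma dsmE a f x : U x -> dsm a f x = pder a f x.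
Proof. exact: cut_pderE. Qed.

Lemma dsmN a f x : ~ U x -> dsm a f x = 0.
Proof. by rewrite /dsm /= /cut_pder => /asboolF ->. Qed.

Lemma smooth_fct_eq (f g : smooth_fct) : (forall x, f x = g x) -> f = g.
Proof. by move=> fg; apply/val_inj/funext. Qed.

Lemma smooth_fctDE (f g : smooth_fct) x : (f + g) x = f x + g x.
Proof. by []. Qed.

Lemma smooth_fctNE (f : smooth_fct) x : (- f) x = - f x.
Proof. by []. Qed.

Lemma smooth_fctME (f g : smooth_fct) x : (f * g) x = f x * g x.
Proof. by []. Qed.

Lemma smooth_fct_sumE I (r : seq I) (P : pred I) (F : I -> smooth_fct) x :
  (\sum_(i <- r | P i) F i) x = \sum_(i <- r | P i) F i x.
Proof. by elim/big_rec2: _ => // i y1 y2 _ <-. Qed.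

Lemma smooth_derivable (f : smooth_fct) x (a : 'I_n) :
  U x -> derivable f x (delta_mx 0 a).
Proof. exact: Ck_derivable (smooth_fctP f 1). Qed.

Lemma dsmD a f g : dsm a (f + g) = dsm a f + dsm a g.
Proof.
apply: smooth_fct_eq => x; rewrite smooth_fctDE.
have [Ux|Ux] := pselect (U x); last by rewrite !dsmN // addr0.
by rewrite !dsmE // /pder deriveD //; exact: smooth_derivable.
Qed.

Lemma dsmM a f g : dsm a (f * g) = dsm a f * g + f * dsm a g.
Proof.
apply: smooth_fct_eq => x; rewrite smooth_fctDE !smooth_fctME.
have [Ux|Ux] := pselect (U x); last by rewrite !dsmN // mul0r mulr0 addr0.
rewrite !dsmE // /pder deriveM; [|exact: smooth_derivable|exact: smooth_derivable].
by rewrite addrC mulrC.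
Qed.

Lemma dsmC a b f : dsm a (dsm b f) = dsm b (dsm a f).
Proof.
apply: smooth_fct_eq => x.
have [Ux|Ux] := pselect (U x); last by rewrite !dsmN.
have E c d : dsm c (dsm d f) x = pder c (pder d f) x.
  rewrite dsmE //; apply: near_eq_derive; apply: near_open oU Ux _ => y.
  exact: dsmE.
by rewrite !E; apply: pderC (smooth_fctP f 2) Ux.
Qed.

Lemma smooth_two_reg (f : smooth_fct) : f + f = 0 -> f = 0.
Proof.
move=> ff; apply: smooth_fct_eq => x; have := congr1 (fun h : smooth_fct => h x) ff.
rewrite smooth_fctDE -mulr2n => /eqP; rewrite mulrn_eq0 /= => /eqP.
by [].
Qed.

End SmoothRing.

Section Evaluation.
Context {R : realType} {n : nat} {U : set 'rV[R]_n} (oU : open U).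

(** Evaluation as a ring morphism, so that [map_mx] carries matrix products and determinants to a
    point. *)
Definition evalat (x : 'rV[R]_n) (f : smooth_fct oU) : R := f x.

Lemma evalat_additive x : zmod_morphism (evalat x).
Proof. by []. Qed.

Lemma evalat_monoid x : monoid_morphism (evalat x).
Proof. by []. Qed.

HB.instance Definition _ x :=
  GRing.isZmodMorphism.Build (smooth_fct oU) R (evalat x) (evalat_additive x).
HB.instance Definition _ x :=
  GRing.isMonoidMorphism.Build (smooth_fct oU) R (evalat x) (evalat_monoid x).

Lemma dsm_pder a (f : smooth_fct oU) h x : U x -> (forall y, U y -> f y = h y) ->
  dsm a f x = pder a h x.
Proof.
by move=> Ux fh; rewrite dsmE //; apply: near_eq_derive; exact: near_open oU Ux fh.
Qed.

Lemma smooth_onW (f h : 'rV[R]_n -> R) : (forall x, U x -> f x = h x) ->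
  smooth_on U f -> smooth_on U h.
Proof. by move=> fh fs k; apply: Ck_on_ext (fs k). Qed.

End Evaluation.

Lemma gradient_mulmx {R : realType} {n : nat} {M : topologicalType}
    {A : manifold R n M} (g : riemannian_metric A) (u : M -> R) (i : chart A) x :
  gradient g u i x = (ginv g i x *m \col_l pder l (loc u i) x)^T.
Proof. by apply/rowP => j; rewrite !mxE; apply: eq_bigr => l _; rewrite !mxE. Qed.

(** * The soliton in a single chart *)

Section Chart.
Context {R : realType} {n : nat} {M : topologicalType} (A : manifold R n M).
Variables (g : riemannian_metric A) (u : M -> R) (lambda : R).
Hypothesis soliton : gradient_ricci_soliton g u lambda.
Variable i : chart A.
Local Notation U := (cod i).
Local Notation oU := (@cod_open _ _ _ _ i).
Local Notation S := (smooth_fct oU).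

Lemma metric_pd x : U x -> posdef (metric g i x).
Proof. by move=> Ux; split; [exact: Defs.metric_sym|exact: metric_posdef]. Qed.

(* Outside the chart the metric is replaced by the identity and [lambda] by [0],
   so that the identities below hold in the ring [S] of total functions. *)
Definition ext_metric (x : 'rV[R]_n) : 'M[R]_n :=
  if `[< U x >] then metric g i x else 1%:M.

Lemma ext_metricE x : U x -> ext_metric x = metric g i x.
Proof. by rewrite /ext_metric => /asboolT ->. Qed.

Lemma ext_metricN x : ~ U x -> ext_metric x = 1%:M.
Proof. by rewrite /ext_metric => /asboolF ->. Qed.

Lemma ext_metric_smooth a b : smooth_on U (fun x => ext_metric x a b).
Proof.
apply: smooth_onW (metric_smooth g i a b); first exact: oU.
by move=> x Ux; rewrite ext_metricE.
Qed.

Definition mS : 'M[S]_n := \matrix_(a, b) to_smooth oU (ext_metric_smooth a b).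

Lemma mS_eval x : map_mx (evalat x) mS = ext_metric x.
Proof. by apply/matrixP => a b; rewrite !mxE. Qed.

Lemma ext_metric_unit x : ext_metric x \in unitmx.
Proof.
have [Ux|Ux] := pselect (U x); last by rewrite ext_metricN // unitmx1.
by rewrite ext_metricE //; apply/posdef_unit/metric_pd.
Qed.

Lemma det_mS_neq0 x : (\det mS : S) x != 0.
Proof.
rewrite -[(\det mS : S) x]/(evalat x (\det mS)) -det_map_mx mS_eval.
by rewrite -unitfE -unitmxE ext_metric_unit.
Qed.

Lemma detV_smooth : smooth_on U (fun x => ((\det mS : S) x)^-1).
Proof.
move=> k; apply: Ck_onV; first exact: oU.
  by move=> x _; exact: det_mS_neq0.
exact: smooth_fctP.
Qed.

(** Cramer's rule: smoothness of the inverse metric reduces to that of the inverse determinant. *)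
Definition mSV : 'M[S]_n := to_smooth oU detV_smooth *: \adj mS.

Lemma mSK : mS *m mSV = 1%:M.
Proof.
rewrite /mSV -scalemxAr mul_mx_adj scale_scalar_mx; congr _%:M.
by apply: smooth_fct_eq => x; rewrite smooth_fctME /= mulVf // det_mS_neq0.
Qed.

Lemma mSVK : mSV *m mS = 1%:M.
Proof.
rewrite /mSV -scalemxAl mul_adj_mx scale_scalar_mx; congr _%:M.
by apply: smooth_fct_eq => x; rewrite smooth_fctME /= mulVf // det_mS_neq0.
Qed.

Lemma mS_sym : mS^T = mS.
Proof.
apply/matrixP => a b; apply: smooth_fct_eq => x; rewrite !mxE /=.
have [Ux|Ux] := pselect (U x); last by rewrite ext_metricN // !mxE eq_sym.
by rewrite ext_metricE // -{1}(Defs.metric_sym g Ux) mxE.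
Qed.

Lemma mSV_eval x : U x -> map_mx (evalat x) mSV = ginv g i x.
Proof.
move=> Ux; have mu := ext_metric_unit x.
apply: (can_inj (mulKmx mu)); rewrite -{1}mS_eval -map_mxM mSK map_mx1.
by rewrite /ginv -ext_metricE // mulmxV.
Qed.

Lemma ginvE x a b : U x -> ginv g i x a b = mSV a b x.
Proof. by move=> Ux; rewrite -mSV_eval // !mxE. Qed.

Lemma half_smooth : smooth_on U (cst 2^-1).
Proof. by move=> k; exact: Ck_on_cst. Qed.

Definition halfS : S := to_smooth oU half_smooth.

Lemma halfSD : halfS + halfS = 1.
Proof.
apply: smooth_fct_eq => x; transitivity (2^-1 + 2^-1 : R) => //.
by transitivity (1 : R) => //; rewrite [RHS]splitr mul1r.
Qed.

Local Notation d := (@dsm R n U oU).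
Definition GamS := levi_civita d mS mSV halfS.

Lemma dmS x a b c : U x -> d a (mS b c) x = pder a (fun y => metric g i y b c) x.
Proof.
by move=> Ux; apply: dsm_pder => // y Uy; rewrite mxE /= ext_metricE.
Qed.

Lemma mSE x a b : U x -> mS a b x = metric g i x a b.
Proof. by move=> Ux; rewrite mxE /= ext_metricE. Qed.

Lemma dmSN x a b c : ~ U x -> d a (mS b c) x = 0.
Proof. exact: dsmN. Qed.

Lemma GamSE x a k c : U x -> GamS a k c x = christoffel g i k a c x.
Proof.
move=> Ux; rewrite mxE smooth_fctME smooth_fct_sumE; congr (_ * _).
apply: eq_bigr => l _; rewrite smooth_fctME ginvE //.
by rewrite !(smooth_fctDE, smooth_fctNE) !dmS.
Qed.

Lemma GamSN x a k c : ~ U x -> GamS a k c x = 0.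
Proof.
move=> Ux; rewrite mxE smooth_fctME smooth_fct_sumE big1 ?mulr0 // => l _.
by rewrite smooth_fctME !(smooth_fctDE, smooth_fctNE) !dmSN // subr0 addr0 mulr0.
Qed.

Definition uS : S := to_smooth oU (soliton.1 i).

Lemma lam_smooth : smooth_on U (fun x => if `[< U x >] then lambda else 0).
Proof.
apply: (@smooth_onW _ _ _ oU (cst lambda)); last by move=> k; exact: Ck_on_cst.
by move=> x /asboolT ->.
Qed.

Definition lamS : S := to_smooth oU lam_smooth.

Lemma lamSE x : U x -> lamS x = lambda.
Proof. by move=> Ux; rewrite /lamS /= asboolT. Qed.

Lemma d_lamS a : d a lamS = 0.
Proof.
apply: smooth_fct_eq => x.
have [Ux|Ux] := pselect (U x); last by rewrite dsmN.
transitivity (pder a (cst lambda) x); last by rewrite /pder derive_cst.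
by apply: dsm_pder => // y Uy; rewrite lamSE.
Qed.

Definition XS : 'cV[S]_n := mSV *m \col_a d a uS.

Lemma XSE x k : U x -> XS k 0 x = gradient g u i x 0 k.
Proof.
move=> Ux; rewrite !mxE smooth_fct_sumE; apply: eq_bigr => l _.
by rewrite smooth_fctME ginvE // !mxE dsmE.
Qed.

Lemma gradS a : (mS *m XS) a 0 = d a uS.
Proof. by rewrite /XS mulmxA mSK mul1mx mxE. Qed.

Lemma d2uS x a b : U x -> d a (d b uS) x = pder a (pder b (loc u i)) x.
Proof. by move=> Ux; apply: dsm_pder => // y Uy; rewrite dsmE. Qed.

Lemma curvS_eval x a b c e : curv d GamS a b e c x =
  d a (GamS b e c) x - d b (GamS a e c) x +
  \sum_f (GamS a e f x * GamS b f c x - GamS b e f x * GamS a f c x).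
Proof.
rewrite curvE smooth_fctDE; congr (_ + _).
by rewrite smooth_fct_sumE.
Qed.

Lemma curvSE x a b c e : U x ->
  curv d GamS a b e c x = riemann g i e c a b x.
Proof.
move=> Ux; rewrite curvS_eval; congr (_ - _ + _).
- by apply: dsm_pder => // y Uy; exact: GamSE.
- by apply: dsm_pder => // y Uy; exact: GamSE.
- apply: eq_bigr => f _; congr (_ * _ - _ * _); exact: GamSE.
Qed.

Lemma curvSN x a b c e : ~ U x -> curv d GamS a b e c x = 0.
Proof.
move=> Ux; rewrite curvS_eval !(dsmN _ _ Ux) subrr add0r big1 // => f _.
by rewrite !(GamSN _ _ _ Ux) !mul0r subrr.
Qed.

Lemma ricciE x a b : U x -> ricci g i x a b = (\sum_e curv d GamS e a e b) x.
Proof.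
by move=> Ux; rewrite mxE smooth_fct_sumE; apply: eq_bigr => e _; rewrite curvSE.
Qed.

Lemma solitonS a b : d a (d b uS) - \sum_k GamS a k b * d k uS
  + \sum_e curv d GamS e a e b = lamS * mS a b.
Proof.
apply: smooth_fct_eq => x.
rewrite !(smooth_fctDE, smooth_fctNE) smooth_fctME.
have [Ux|Ux] := pselect (U x); last first.
  have -> : lamS x = 0 by rewrite /lamS /= asboolF.
  rewrite mul0r dsmN // !smooth_fct_sumE !big1 ?subrr ?addr0 //.
    by move=> e _; exact: curvSN.
  by move=> k _; rewrite smooth_fctME GamSN // mul0r.
have H : hessian g u i x a b + ricci g i x a b = lambda * metric g i x a b.
  by rewrite -addmxE (soliton.2 i x Ux) mxE.
rewrite (lamSE Ux) (mSE _ _ Ux) -H -(ricciE _ _ Ux) (d2uS _ _ Ux).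
rewrite [hessian _ _ _ _ _ _]mxE.
congr (_ - _ + _); rewrite smooth_fct_sumE; apply: eq_bigr => k _.
by rewrite smooth_fctME GamSE // dsmE.
Qed.


Definition dmetric (a : 'I_n) (x : 'rV[R]_n) : 'M[R]_n :=
  \matrix_(b, c) pder a (fun y => metric g i y b c) x.

(* The trace of the Hessian, written as the divergence of the gradient. *)
Definition laplacian (x : 'rV[R]_n) : R :=
  \sum_a pder a (fun y => gradient g u i y 0 a) x +
  2^-1 * \sum_e \tr (ginv g i x *m dmetric e x) * gradient g u i x 0 e.

Definition grad_sqr (x : 'rV[R]_n) : R :=
  \sum_k gradient g u i x 0 k * pder k (loc u i) x.

Local Notation dcovS := (dcov d GamS XS).

Lemma laplacianE x : U x -> (\sum_a dcovS a a 0) x = laplacian x.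
Proof.
move=> Ux; have -> : \sum_a dcovS a a 0 = \sum_a d a (XS a 0) +
    halfS * \sum_e (\sum_a \sum_l mSV a l * d e (mS l a)) * XS e 0.
  transitivity (\sum_a d a (XS a 0) + \sum_a \sum_e GamS a a e * XS e 0).
    by rewrite -big_split; apply: eq_bigr => a _; rewrite dcovE.
  congr (_ + _); rewrite exchange_big mulr_sumr; apply: eq_bigr => e _.
  rewrite -mulr_suml mulrA; congr (_ * _).
  exact: levi_civita_trace mS_sym (G'sym mSK mS_sym) e.
rewrite smooth_fctDE smooth_fctME; congr (_ + _ * _).
  rewrite smooth_fct_sumE; apply: eq_bigr => a _; apply: dsm_pder => // y Uy.
  by rewrite XSE.
rewrite smooth_fct_sumE.
apply: eq_bigr => e _; rewrite smooth_fctME XSE //; congr (_ * _).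
rewrite smooth_fct_sumE; apply: eq_bigr => a _.
rewrite mxE smooth_fct_sumE; apply: eq_bigr => l _.
by rewrite smooth_fctME ginvE // dmS // [dmetric _ _ _ _]mxE.
Qed.

Lemma grad_sqrE x : U x -> (XS^T *m mS *m XS) 0 0 x = grad_sqr x.
Proof.
move=> Ux; rewrite -mulmxA mxE smooth_fct_sumE; apply: eq_bigr => k _.
by rewrite smooth_fctME gradS mxE XSE // dsmE.
Qed.

Lemma grad_sqr_inner x : U x ->
  grad_sqr x = inner g i x (gradient g u i x) (gradient g u i x).
Proof.
move=> Ux; rewrite /inner -mulmxA mxE; apply: eq_bigr => k _; congr (_ * _).
rewrite [in RHS]gradient_mulmx.
by rewrite trmxK mulmxA mulmxV ?mul1mx ?mxE //; apply/posdef_unit/metric_pd.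
Qed.

(** Hamilton's function less the constant [n lambda], as [- laplacian] stands for
    [scal - n lambda]. *)
Definition potential (x : 'rV[R]_n) : R :=
  grad_sqr x - laplacian x - lambda * loc u i x *+ 2.

Lemma potential_cst x b : U x ->
  derivable potential x (delta_mx 0 b) /\ pder b potential x = 0.
Proof.
pose F : S := (XS^T *m mS *m XS) 0 0 - \sum_a dcovS a a 0 - lamS * uS *+ 2.
have FE y : U y -> F y = potential y.
  move=> Uy; rewrite /F /potential -grad_sqrE // -laplacianE // -(lamSE Uy).
  by rewrite !mulr2n.
have dF : d b F = 0.
  have Gs := G'sym mSK mS_sym.
  exact: (hamilton_identity (@dsmD _ _ _ oU) (@dsmM _ _ _ oU) (@dsmC _ _ _ oU)
    mSK mSVK mS_sym (levi_civita_compat d halfSD mSK mS_sym)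
    (levi_civita_torsion_free d mSV halfS mS_sym) (@smooth_two_reg _ _ _ oU)
    d_lamS gradS solitonS).
move=> Ux; have nF := near_open oU Ux FE; split.
  have fd : derivable F x (delta_mx 0 b) by exact: smooth_derivable.
  exact: near_eq_derivable nF fd.
by rewrite /pder -(near_eq_derive _ nF) -/(pder b F x) -dsmE // dF.
Qed.

Lemma laplacian_soliton x : U x -> laplacian x =
  lambda *+ n - \sum_a \sum_b ricci g i x a b * ginv g i x b a.
Proof.
move=> Ux; rewrite -laplacianE //.
have -> : \sum_a dcovS a a 0 = \sum_(a < n) lamS - \sum_a \sum_b
    (\sum_e curv d GamS e a e b) * mSV b a.
  rewrite -sumrB; apply: eq_bigr => a _.
  have := mixed_soliton (@dsmD _ _ _ oU) (@dsmM _ _ _ oU) mSK mSVK mS_sym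
    (levi_civita_compat d halfSD mSK mS_sym) gradS solitonS a a.
  rewrite eqxx => <-; rewrite -addrA -[LHS]addr0; congr (_ + _).
  apply/esym/eqP; rewrite subr_eq0; apply/eqP.
  under [RHS]eq_bigr => b _ do rewrite mulr_suml.
  by rewrite exchange_big; apply: eq_bigr => e _; rewrite mxE.
rewrite smooth_fctDE smooth_fctNE !smooth_fct_sumE; congr (_ - _).
  by rewrite (eq_bigr (fun=> lambda)) ?sumr_const ?card_ord // => a _; rewrite lamSE.
apply: eq_bigr => a _; rewrite smooth_fct_sumE; apply: eq_bigr => b _.
by rewrite smooth_fctME ginvE // ricciE.
Qed.

(** In the trace of the soliton equation, [tr_bound] keeps the trace of [ricci] above [- K *+ n]. *)
Lemma laplacian_bound x (K : R) : U x ->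
  tensor_norm g i x (ricci g i x) <= K -> laplacian x <= lambda *+ n + K *+ n.
Proof.
move=> Ux rK; rewrite laplacian_soliton // lerD2l.
have := tr_bound (posdef_inv (metric_pd Ux)) rK.
by rewrite ler_norml => /andP[+ _]; rewrite lerNl.
Qed.

End Chart.

(** * Change of charts *)

Section MatrixDerivative.
Context {R : realType} {n : nat}.
Local Notation e_ a := (delta_mx 0 a : 'rV[R]_n).

Definition dmat p q (a : 'I_n) (F : 'rV[R]_n -> 'M[R]_(p, q)) (x : 'rV[R]_n) :
  'M[R]_(p, q) := \matrix_(k, l) pder a (fun y => F y k l) x.

Definition mx_derivable p q (a : 'I_n) (F : 'rV[R]_n -> 'M[R]_(p, q)) x :=
  forall k l, derivable (fun y => F y k l) x (e_ a).

Lemma is_derive_mulmx p q r a (F : 'rV[R]_n -> 'M[R]_(p, q))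
    (K : 'rV[R]_n -> 'M[R]_(q, r)) x k l :
  mx_derivable a F x -> mx_derivable a K x ->
  is_derive x (e_ a) (fun y => (F y *m K y) k l)
    ((dmat a F x *m K x + F x *m dmat a K x) k l).
Proof.
move=> dF dK.
have -> : (fun y => (F y *m K y) k l) =
    \sum_j ((fun y => F y k j) * (fun y => K y j l)).
  apply/funext => y; rewrite mxE fct_sumE; exact: eq_bigr.
have H j : is_derive x (e_ a) ((fun y => F y k j) * (fun y => K y j l))
    (dmat a F x k j * K x j l + F x k j * dmat a K x j l).
  have ? := derivableP (dF k j); have ? := derivableP (dK j l).
  apply: is_derive_eq; rewrite !mxE /GRing.scale /= addrC; congr (_ + _).
  exact: mulrC.
have S := is_derive_sum (fun j => H j).
by apply: (is_derive_eq S); rewrite !mxE -big_split.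
Qed.

Lemma mx_derivableM p q r a (F : 'rV[R]_n -> 'M[R]_(p, q))
    (K : 'rV[R]_n -> 'M[R]_(q, r)) x :
  mx_derivable a F x -> mx_derivable a K x ->
  mx_derivable a (fun y => F y *m K y) x.
Proof. by move=> dF dK k l; have [] := is_derive_mulmx k l dF dK. Qed.

Lemma dmatM p q r a (F : 'rV[R]_n -> 'M[R]_(p, q))
    (K : 'rV[R]_n -> 'M[R]_(q, r)) x :
  mx_derivable a F x -> mx_derivable a K x ->
  dmat a (fun y => F y *m K y) x = dmat a F x *m K x + F x *m dmat a K x.
Proof.
move=> dF dK; apply/matrixP => k l; rewrite mxE.
by have [_ E] := is_derive_mulmx k l dF dK.
Qed.

Lemma dmatT p q a (F : 'rV[R]_n -> 'M[R]_(p, q)) x :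
  dmat a (fun y => (F y)^T) x = (dmat a F x)^T.
Proof.
apply/matrixP => k l; rewrite !mxE; congr (pder a _ x).
by apply/funext => y; rewrite mxE.
Qed.

Lemma mx_derivableT p q a (F : 'rV[R]_n -> 'M[R]_(p, q)) x :
  mx_derivable a F x -> mx_derivable a (fun y => (F y)^T) x.
Proof.
move=> dF k l; have -> : (fun y => (F y)^T k l) = (fun y => F y l k).
  by apply/funext => y; rewrite mxE.
exact: dF.
Qed.

Lemma near_eq_dmat p q a (F K : 'rV[R]_n -> 'M[R]_(p, q)) x :
  (\forall y \near x, F y = K y) -> dmat a F x = dmat a K x.
Proof.
move=> FK; apply/matrixP => k l; rewrite !mxE; apply: near_eq_derive.
by apply: filterS FK => y ->.
Qed.

End MatrixDerivative.

Section Transition.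
Context {R : realType} {n : nat} {M : topologicalType} (A : manifold R n M).
Variables (g : riemannian_metric A) (u : M -> R) (lambda : R).
Hypothesis soliton : gradient_ricci_soliton g u lambda.

Lemma gradient_Ck i k a : Ck_on k (cod i) (fun y => gradient g u i y 0 a).
Proof.
apply: (Ck_on_ext (@cod_open _ _ _ _ i) _ (smooth_fctP (XS soliton i a 0) k)).
by move=> y Uy; rewrite XSE.
Qed.

Variables (i j : chart A).
Local Notation tau := (fun y => phi j (psi i y)).
Local Notation W := (cod i `&` psi i @^-1` dom j).

Lemma overlap_open : open W.
Proof.
rewrite openE => x [Ux Dx].
have n1 : nbhs x (cod i) := open_nbhs_nbhs (conj (@cod_open _ _ _ _ i) Ux).
have n2 : nbhs x (psi i @^-1` dom j).
  by apply: (psi_continuous Ux); exact: open_nbhs_nbhs (conj (@dom_open _ _ _ _ j) Dx).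
exact: filterI n1 n2.
Qed.

Lemma tau_cod x : W x -> cod j (tau x).
Proof. by move=> [_ Dx]; exact: phi_cod. Qed.

(** Rows are indexed by the source coordinates: the metric pulls back as [J H J^T], and vector
    columns push forward by [J^T]. *)
Definition jac (y : 'rV[R]_n) : 'M[R]_n := \matrix_(a, k) pder a (fun z => tau z 0 k) y.

Lemma tau_Ck m k : Ck_on m W (fun y => tau y 0 k).
Proof. exact: transition_smooth. Qed.

Lemma jac_derivable a x : W x -> mx_derivable a jac x.
Proof.
move=> Wx b k; have -> : (fun y => jac y b k) = pder b (fun z => tau z 0 k).
  by apply/funext => y; rewrite mxE.
exact: Ck_derivable (Ck_pder b (tau_Ck 2 k)) Wx.
Qed.

Lemma metric_jac x : W x ->
  metric g i x = jac x *m metric g j (tau x) *m (jac x)^T.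
Proof.
move=> [Ux Dx]; apply/matrixP => a b; rewrite (metric_transition g Ux Dx) mxE.
rewrite exchange_big; apply: eq_bigr => l _; rewrite !mxE mulr_suml.
by apply: eq_bigr => k _; rewrite !mxE mulrAC.
Qed.

Lemma tau_chain f a x : Ck_on 1 (cod j) f -> W x ->
  is_derive x (delta_mx 0 a) (f \o tau) (\sum_k jac x a k * pder k f (tau x)).
Proof.
move=> f1 Wx; have H := chain_rule (@cod_open _ _ _ _ j) f1 (tau_cod Wx)
  (fun k => Ck_derivable (a := a) (tau_Ck 1 k) Wx).
by apply: is_derive_eq H _; apply: eq_bigr => k _; rewrite mxE.
Qed.

(** The metric in chart [i] is invertible and has [jac x] as a factor, so the inverse transition map
    need not be differentiated. *)
Lemma jac_unit x : W x -> jac x \in unitmx.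
Proof.
move=> Wx; have := posdef_unit (metric_pd g Wx.1); rewrite metric_jac //.
by rewrite unitmx_mul unitmx_mul => /andP[/andP[]].
Qed.

Lemma metric_tau_unit x : W x -> metric g j (tau x) \in unitmx.
Proof. by move=> Wx; exact: posdef_unit (metric_pd g (tau_cod Wx)). Qed.

Lemma loc_tau x : W x -> loc u i x = loc u j (tau x).
Proof. by move=> [_ Dx]; rewrite /loc phiK. Qed.

Lemma pder_loc_tau x : W x -> \col_l pder l (loc u i) x =
  jac x *m \col_l pder l (loc u j) (tau x).
Proof.
move=> Wx; apply/colP => a; rewrite !mxE.
transitivity (pder a (loc u j \o tau) x).
  apply: near_eq_derive; apply: near_open overlap_open Wx _ => y Wy.
  exact: loc_tau.
rewrite /pder; have [_ ->] := tau_chain a (soliton.1 j 1) Wx.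
by apply: eq_bigr => k _; rewrite [(\col_l _) _ _]mxE.
Qed.

Lemma gradient_tau x : W x ->
  (gradient g u j (tau x))^T = (jac x)^T *m (gradient g u i x)^T.
Proof.
move=> Wx; rewrite !gradient_mulmx !trmxK pder_loc_tau // /ginv metric_jac //.
have Ju := jac_unit Wx; have Hu := metric_tau_unit Wx.
have JTu : (jac x)^T \in unitmx by rewrite unitmx_tr.
have JHu : jac x *m metric g j (tau x) \in unitmx by rewrite unitmx_mul Ju.
have u1 : jac x *m metric g j (tau x) *m (jac x)^T \in unitmx by rewrite unitmx_mul JHu.
set p := \col_l _; apply: (can_inj (mulKmx Hu)); apply: (can_inj (mulKmx Ju)).
by rewrite (mulKVmx Hu) !mulmxA (mulmxV u1) mul1mx.
Qed.

Lemma grad_sqr_tau x : W x -> grad_sqr g u i x = grad_sqr g u j (tau x).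
Proof.
move=> Wx.
have E k y : grad_sqr g u k y =
    (gradient g u k y *m \col_l pder l (loc u k) y) 0 0.
  by rewrite mxE; apply: eq_bigr => l _; rewrite [(\col_l _) _ _]mxE.
rewrite !E pder_loc_tau // -[gradient g u j _]trmxK gradient_tau //.
by rewrite trmx_mul !trmxK mulmxA.
Qed.

(** This is [divergence_invariant] at [x]: its hypotheses are the derivatives of [metric_jac] and
    [gradient_tau], valid near [x], and the symmetry of the second derivatives of the transition
    map. *)
Lemma laplacian_tau x : W x -> laplacian g u i x = laplacian g u j (tau x).
Proof.
move=> Wx; have nW := near_open overlap_open Wx.
have gd k a y : cod k y -> mx_derivable a (fun y => (gradient g u k y)^T) y.
  move=> Uy; apply: mx_derivableT => b c; rewrite ord1.
  exact: Ck_derivable (gradient_Ck k 1 c) Uy.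
have md a : mx_derivable a (fun y => metric g j (tau y)) x.
  by move=> b c; have [] := tau_chain a (metric_smooth g j b c 1) Wx.
have Jd a : mx_derivable a jac x by exact: jac_derivable.
have DGE e : dmetric g i e x = dmat e jac x *m metric g j (tau x) *m (jac x)^T
   + jac x *m (\sum_m jac x e m *: dmetric g j m (tau x)) *m (jac x)^T
   + jac x *m metric g j (tau x) *m (dmat e jac x)^T.
  transitivity (dmat e (fun y => jac y *m metric g j (tau y) *m (jac y)^T) x).
    by apply: near_eq_dmat; apply: nW => y Wy; exact: metric_jac.
  rewrite dmatM; [|exact: mx_derivableM|exact: mx_derivableT].
  rewrite dmatM // dmatT mulmxDl; congr (_ + _ *m _ *m _ + _).
  apply/matrixP => b c; rewrite summxE mxE /pder.
  have [_ ->] := tau_chain e (metric_smooth g j b c 1) Wx.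
  by apply: eq_bigr => k _; rewrite [in RHS]mxE [dmetric _ _ _ _ _ _]mxE.
pose Dg k a := dmat a (fun y => (gradient g u k y)^T).
have DYE a : \sum_m jac x a m *: Dg j m (tau x) =
    (dmat a jac x)^T *m (gradient g u i x)^T + (jac x)^T *m Dg i a x.
  transitivity (dmat a (fun y => (jac y)^T *m (gradient g u i y)^T) x); last first.
    by rewrite (dmatM (mx_derivableT (Jd a)) (gd i a x Wx.1)) (dmatT a jac).
  transitivity (dmat a (fun y => (gradient g u j (tau y))^T) x); last first.
    by apply: near_eq_dmat; apply: nW => y Wy; exact: gradient_tau.
  rewrite dmatT; apply/matrixP => b c; rewrite summxE [RHS]mxE mxE ord1 /pder.
  have [_ ->] := tau_chain a (gradient_Ck j 1 b) Wx.
  by apply: eq_bigr => k _; rewrite /Dg dmatT !mxE.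
have DJC a b k : dmat a jac x b k = dmat b jac x a k.
  have E c d : dmat c jac x d k = pder c (pder d (fun z => tau z 0 k)) x.
    rewrite mxE; congr (pder c _ x); apply/funext => y; by rewrite mxE.
  have C := pderC a b overlap_open (tau_Ck 2 k) Wx.
  exact: (etrans (E a b) (etrans C (esym (E b a)))).
have two : (2 : R) != 0 by rewrite pnatr_eq0.
have L := divergence_invariant two (jac_unit Wx) (metric_tau_unit Wx) DGE DYE DJC.
rewrite -metric_jac // -gradient_tau // in L.
have E k y : laplacian g u k y = \sum_a Dg k a y a 0 +
    2^-1 * \sum_e \tr (invmx (metric g k y) *m dmetric g k e y) *
      (gradient g u k y)^T e 0.
  congr (_ + _ * _); apply: eq_bigr => a _; first by rewrite /Dg dmatT !mxE.
  by congr (_ * _); rewrite [RHS]mxE.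
exact: (etrans (E i x) (etrans L (esym (E j (tau x))))).
Qed.

Lemma potential_tau x : W x ->
  potential g u lambda i x = potential g u lambda j (tau x).
Proof.
by move=> Wx; rewrite /potential grad_sqr_tau // laplacian_tau // loc_tau.
Qed.

End Transition.

(** * Global argument *)

Lemma connected_locally_constant (M : topologicalType) (T : Type) (h : M -> T) :
  connected [set: M] -> (forall p, \forall q \near p, h q = h p) ->
  forall p q, h p = h q.
Proof.
move=> cM hl p q; pose B := [set r | h p = h r].
have oB : open B.
  rewrite openE => r Br; apply: filterS (hl r) => s; rewrite /B /= => ->.
  exact: Br.
have cB : closed B.
  rewrite -[B]setCK; apply: open_closedC; rewrite openE => r Br.
  by apply: filterS (hl r) => s; rewrite /B /= => ->.
have -> : h q = h p; last by [].
suff : B q by [].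
rewrite (cM B) //; first by exists p.
- by exists B => //; rewrite setTI.
- by exists B => //; rewrite setTI.
Qed.

Section Global.
Context {R : realType} {n : nat} {M : topologicalType} (A : manifold R n M).

Lemma pder0_constant (h : M -> R) :
  (forall (i : chart A) x, cod i x -> forall a,
    derivable (loc h i) x (delta_mx 0 a) /\ pder a (loc h i) x = 0) ->
  forall p q, h p = h q.
Proof.
move=> dh; apply: (connected_locally_constant (mfd_connected A)) => p.
have [i Dp] := dom_cover A p.
have nh := pder0_nbhs_cst (@cod_open _ _ _ _ i) (phi_cod Dp) (dh i).
have nD : nbhs p (dom i) := open_nbhs_nbhs (conj (@dom_open _ _ _ _ i) Dp).
have nP := phi_continuous Dp nh.
apply: filterS (filterI nD nP) => q [Dq]; rewrite /= /loc.
by rewrite (phiK Dq) (phiK Dp).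
Qed.

Variables (g : riemannian_metric A) (u : M -> R) (lambda : R).
Hypothesis soliton : gradient_ricci_soliton g u lambda.

Lemma hamilton_constant : exists C : R, forall (i : chart A) x, cod i x ->
  potential g u lambda i x = C.
Proof.
have /choice[c cP] (p : M) : exists i : chart A, dom i p := dom_cover A p.
(* Choosing a chart at each point makes the potential a function on [M]; by [potential_tau] the
   choice does not affect its value, so [h] has the derivatives of the potential in every chart. *)
pose h p := potential g u lambda (c p) (phi (c p) p).
have hE i x : cod i x -> h (psi i x) = potential g u lambda i x.
  move=> Ux; apply/esym.
  exact: (potential_tau soliton (i := i) (j := c (psi i x)) (conj Ux (cP _))).
have hc : forall p q, h p = h q.
  apply: pder0_constant => i x Ux a.
  have nE : \forall y \near x, potential g u lambda i y = loc h i y.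
    by apply: near_open (@cod_open _ _ _ _ i) Ux _ => y Uy; rewrite -hE.
  have [d1 d2] := potential_cst soliton a Ux; split.
    exact: near_eq_derivable nE d1.
  by rewrite /pder -(near_eq_derive _ nE).
(* On an empty [M] any constant will do. *)
have [[p _]|M0] := pselect (exists p : M, True).
  by exists (h p) => i x Ux; rewrite -hE.
by exists 0 => i x Ux; case: M0; exists (psi i x).
Qed.

Lemma grad_sqr_ge0 (i : chart A) x : cod i x -> 0 <= grad_sqr g u i x.
Proof.
move=> Ux; rewrite grad_sqr_inner // /inner.
have [->|v0] := eqVneq (gradient g u i x) 0; first by rewrite !mul0mx mxE.
exact/ltW/metric_posdef.
Qed.

Lemma soliton_lower_bound (K : R) : bounded_ricci g K ->
  exists C : R, forall p, C <= lambda * u p.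
Proof.
move=> rK; have [C CP] := hamilton_constant.
(* From [2 lambda u = |grad u|^2 - laplacian - C], drop the square and bound the Laplacian from
   above. *)
exists ((- C - (lambda *+ n + K *+ n)) / 2) => p.
have [i Dp] := dom_cover A p; have Ux := phi_cod Dp.
have lb := laplacian_bound soliton Ux (rK _ _ Ux).
have g0 := grad_sqr_ge0 Ux; have := CP i _ Ux.
rewrite /potential /loc phiK // ler_pdivrMr // mulr2n => E.
lra.
Qed.

Lemma convex_unbounded (f : M -> R) : complete_metric g -> convex_fun g f ->
  (exists p q : M, f p <> f q) -> forall B : R, exists p, B < f p.
Proof.
move=> gc [fs fc] [p [q pq]] B.
have [i [x [a [Ux fx0]]]] : exists (i : chart A) x a,
    cod i x /\ pder a (loc f i) x <> 0.
  apply: contrapT => nex; apply/pq/pder0_constant => i x Ux a; split.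
    exact: Ck_derivable (fs i 1) Ux.
  by apply: contrapT => f0; apply: nex; exists i, x, a.
pose v := gradient g f i x.
have v0 : v != 0.
  apply/eqP => v0; apply: fx0; have := gradient_mulmx g f i x.
  rewrite -/v v0 => /(congr1 trmx); rewrite trmxK trmx0.
  move=> /(congr1 (mulmx (metric g i x))); rewrite mulmx0 mulmxA mulmxV; last first.
    exact: posdef_unit (metric_pd g Ux).
  by rewrite mul1mx => /colP/(_ a); rewrite !mxE.
have c0 : 0 < inner g i x v v by exact: metric_posdef.
(* Chosen so that [s] times the squared norm of [v] exceeds [B - f q] at the base point [q]; the
   convexity inequality then puts [f (exp_q (s v))] above [B]. *)
pose s := (1 + `|B - f (psi i x)|) / inner g i x v v.
have Dq := psi_dom Ux; have xE := psiK Ux.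
have [gam gamP] := gc _ i Dq (s *: v).
have := fc _ i Dq (s *: v) (gam 1); rewrite xE.
have -> : inner g i x v (s *: v) = s * inner g i x v v.
  by rewrite /inner linearZ /= -scalemxAr mxE.
have -> : s * inner g i x v v = 1 + `|B - f (psi i x)|.
  by rewrite /s divfK // gt_eqF.
move=> H; exists (gam 1).
have {}H := H (ex_intro2 _ _ gam gamP erefl).
have := ler_norm (B - f (psi i x)); move: H.
set t := `|_|; set y := f (psi i x); set z := f (gam 1); lra.
Qed.

End Global.

Theorem theorem3p1 (R : realType) (n : nat) (n_ge2 : (2 <= n)%N)
    (M : topologicalType) (A : manifold R n M) (g : riemannian_metric A)
    (g_complete : complete_metric g)
    (u : M -> R) (lambda : R)
    (soliton : gradient_ricci_soliton g u lambda)
    (u_nonconstant : exists p q : M, u p <> u q)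
    (u_concave : concave_fun g u)
    (ricci_bounded : exists2 K : R, 0 < K & bounded_ricci g K) :
  lambda <= 0.
Proof.
rewrite leNgt; apply/negP => l0.
have [K _ rK] := ricci_bounded.
have [C CP] := soliton_lower_bound soliton rK.
have [p [q upq]] := u_nonconstant.
(* A point with [- u > - C / lambda] has [lambda * u < C], against the lower bound. *)
have [|r] := convex_unbounded g_complete u_concave _ (- C / lambda).
  by exists p, q => /oppr_inj.
by rewrite mulNr ltrN2 ltr_pdivlMr // mulrC ltNge CP.
Qed.
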